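(* Let $0<\alpha<1$, $\nu>0$, $T>1$, let $G\subset\mathbb{R}^n$ be a bounded domain with smooth boundary $\partial G$, and put $\Omega=G\times(1,T]$. Let $F$ (on $\overline\Omega$), $\psi$ (on $\partial G\times[1,T]$) and $\varphi,\bar\varphi$ (on $\bar G$) be continuous. Suppose $u$ and $\bar u$ are solutions of $$v_t(x,t)=\nu\,\Delta_x D_t^{1-\alpha}v(x,t)+F(x,t),\quad (x,t)\in\Omega,$$ that satisfy the same boundary condition $v(x,t)=\psi(x,t)$ for $x\in\partial G$, $1\le t\le T$, and the initial conditions $u(x,1)=\varphi(x)$ and $\bar u(x,1)=\bar\varphi(x)$, $x\in\bar G$. If $\max_{x\in\bar G}|\varphi(x)-\bar\varphi(x)|\le\delta$, then $$|u(x,t)-\bar u(x,t)|\le\delta\quad\text{for all }(x,t)\in\overline\Omega .$$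
   Context: $\Delta_x=\sum_{j=1}^n\partial^2/\partial x_j^2$, $\overline\Omega=\bar G\times[1,T]$, and $D_t^{1-\alpha}$ is the Hadamard fractional derivative of order $1-\alpha$ in $t$ with base point $1$: $$D_t^{1-\alpha}v(x,t)=t\frac{\partial}{\partial t}I_t^{\alpha}v(x,t),\qquad I_t^{\alpha}v(x,t)=\frac{1}{\Gamma(\alpha)}\int_1^t\left(\log\frac{t}{s}\right)^{\alpha-1}v(x,s)\,\frac{ds}{s}.$$ Solutions are classical: $v\in C(\overline\Omega)$ is real-valued, $v_t$ exists in $\Omega$, $I_t^{\alpha}v(x,\cdot)\in W^1_2([1,T])$ (Sobolev space) for each $x\in G$, $D_t^{1-\alpha}v$ exists in $\Omega$ and is twice continuously differentiable in $x$ there, and the equation holds at every point of $\Omega$. *)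

(* Defs.v *)
From mathcomp Require Import all_boot all_order all_algebra.
From mathcomp Require Import all_classical all_reals all_analysis.

Set Implicit Arguments.
Unset Strict Implicit.
Unset Printing Implicit Defensive.

Import Order.TTheory GRing.Theory Num.Theory.
Import numFieldNormedType.Exports.

Local Open Scope classical_set_scope.
Local Open Scope ring_scope.

(* Derivative of f at t relative to A: difference quotients are taken inside A
   only.  With A = [1, T] it is the ordinary derivative for 1 < t < T and the
   left derivative at t = T; values of f outside A play no role. *)
Definition diff_quot (R : realType) (f : R -> R) (t : R) : R -> R :=
  fun s => (s - t)^-1 * (f s - f t).

Definition derivable_within (R : realType) (A : set R) (f : R -> R) (t : R)
    : Prop :=
  cvg (diff_quot f t @ within A (dnbhs t)).

Definition derive_within (R : realType) (A : set R) (f : R -> R) (t : R) : R :=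
  lim (diff_quot f t @ within A (dnbhs t)).

Definition base_vec (R : realType) (n : nat) (i : 'I_n) : 'rV[R]_n :=
  delta_mx 0 i.

(* partials [:: i_1; ...; i_k] f is d/dx_{i_1} (... (d/dx_{i_k} f)). *)
Fixpoint partials (R : realType) (n : nat) (s : seq 'I_n) (f : 'rV[R]_n -> R)
    : 'rV[R]_n -> R :=
  if s is i :: s' then fun x => 'D_(base_vec R i) (partials s' f) x else f.

Definition laplacian (R : realType) (n : nat) (f : 'rV[R]_n -> R)
    (x : 'rV[R]_n) : R :=
  \sum_(i < n) partials [:: i; i] f x.

Definition smooth_on (R : realType) (n : nat) (U : set 'rV[R]_n)
    (f : 'rV[R]_n -> R) : Prop :=
  forall (s : seq 'I_n) (x : 'rV[R]_n), U x ->
    {for x, continuous (partials s f)} /\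
    forall i : 'I_n, derivable (partials s f) x (base_vec R i).

Definition bdry (R : realType) (n : nat) (G : set 'rV[R]_n) : set 'rV[R]_n :=
  closure G `\` interior G.

(* Near each of its boundary points, G is the set where a smooth function with
   nonvanishing gradient is negative. *)
Definition smooth_boundary (R : realType) (n : nat) (G : set 'rV[R]_n) : Prop :=
  forall x0, bdry G x0 ->
    exists (U : set 'rV[R]_n) (rho : 'rV[R]_n -> R),
      [/\ open U, U x0, smooth_on U rho,
          (forall x, U x -> exists i : 'I_n, partials [:: i] rho x != 0) &
          G `&` U = U `&` [set x | rho x < 0]].

Definition smooth_bounded_domain (R : realType) (n : nat) (G : set 'rV[R]_n)
    : Prop :=
  [/\ G !=set0, open G, connected G, bounded_set G & smooth_boundary G].

Definition Omega (R : realType) (n : nat) (G : set 'rV[R]_n) (T : R)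
    : set ('rV[R]_n * R) :=
  G `*` `]1, T].

Definition Omega_bar (R : realType) (n : nat) (G : set 'rV[R]_n) (T : R)
    : set ('rV[R]_n * R) :=
  closure G `*` `[1, T].

Definition Gamma (R : realType) (a : R) : R :=
  \int[lebesgue_measure]_(s in `]0, +oo[) (s `^ (a - 1) * expR (- s)).

Definition hadamard_int (R : realType) (alpha : R) (f : R -> R) (t : R) : R :=
  (Gamma alpha)^-1 *
  \int[lebesgue_measure]_(s in `[1, t]) (ln (t / s) `^ (alpha - 1) * f s / s).

(* The Hadamard derivative of order 1 - alpha (not alpha), for t in ]1, T]. *)
Definition hadamard_deriv (R : realType) (T alpha : R) (f : R -> R) (t : R)
    : R :=
  t * derive_within `[1, T] (hadamard_int alpha f) t.

Definition square_integrable (R : realType) (a b : R) (f : R -> R) : Prop :=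
  measurable_fun `[a, b] f /\
  lebesgue_measure.-integrable `[a, b] (fun t => (f t ^+ 2)%:E).

Definition test_function (R : realType) (a b : R) (phi : R -> R) : Prop :=
  (forall (k : nat) (t : R), derivable (derive1n k phi) t 1) /\
  exists c d : R, [/\ a < c, c < d, d < b &
    forall t, t \notin `[c, d] -> phi t = 0].

Definition sobolev_W12 (R : realType) (a b : R) (f : R -> R) : Prop :=
  square_integrable a b f /\
  exists2 g : R -> R, square_integrable a b g &
    forall phi : R -> R, test_function a b phi ->
      \int[lebesgue_measure]_(t in `[a, b]) (f t * derive1 phi t) =
      - \int[lebesgue_measure]_(t in `[a, b]) (g t * phi t).

(* D^{1-alpha}_t v, as a function of (x, t), has x-partial derivatives of all
   orders <= 2 in Omega, and these are continuous functions on Omega. *)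
Definition hadamard_C2x (R : realType) (n : nat) (G : set 'rV[R]_n)
    (T alpha : R) (v : 'rV[R]_n -> R -> R) : Prop :=
  let D t := fun x => hadamard_deriv T alpha (v x) t in
  (forall (s : seq 'I_n) (i : 'I_n) x t, (size s < 2)%N -> Omega G T (x, t) ->
     derivable (partials s (D t)) x (base_vec R i)) /\
  (forall s : seq 'I_n, (size s <= 2)%N ->
     {within Omega G T, continuous (fun p => partials s (D p.2) p.1)}).

Record classical_solution (R : realType) (n : nat) (G : set 'rV[R]_n)
    (T alpha nu : R) (F v : 'rV[R]_n -> R -> R) : Prop := ClassicalSolution {
  sol_continuous :
    {within Omega_bar G T, continuous (fun p => v p.1 p.2)} ;
  sol_dt : forall x t, Omega G T (x, t) -> derivable_within `[1, T] (v x) t ;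
  sol_W12 : forall x, G x -> sobolev_W12 1 T (hadamard_int alpha (v x)) ;
  sol_hadamard : forall x t, Omega G T (x, t) ->
    derivable_within `[1, T] (hadamard_int alpha (v x)) t ;
  sol_C2x : hadamard_C2x G T alpha v ;
  sol_equation : forall x t, Omega G T (x, t) ->
    derive_within `[1, T] (v x) t =
    nu * laplacian (fun y => hadamard_deriv T alpha (v y) t) x + F x t
}.

(* Main.v *)
Require Import Defs.
From HB Require Import structures.
From mathcomp Require Import all_boot all_order all_algebra.
From mathcomp Require Import all_classical all_reals all_analysis.
From mathcomp Require Import measurable_realfun.
From mathcomp Require Import ring lra.
Import Order.TTheory GRing.Theory Num.Theory.
Import numFieldNormedType.Exports.
Local Open Scope classical_set_scope.
Local Open Scope ring_scope.

(** Put w = u - ubar, W = w - delta and H = I^alpha W, where I^b is the Hadamard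
integral of order b, taken without the factor 1/Gamma(b). The hypotheses are
symmetric in u and ubar, so it suffices to show W <= 0.

The equation says w_t = nu * Laplacian of t * dH/dt, and at points where
t * dH/dt is positive and maximal one expects a contradiction from a maximum
principle. As t * dH/dt is only known to exist for t > 1, the proof works with
the dilation increments k_q(x, t) = H(x, q * t) - H(x, t), q > 1, extended by
H = 0 for t <= 1, and shows that they are at most o(q - 1).

Time. By the semigroup property (had_had) and the invariance of the kernel under
dilations, I^(1 - alpha) k_q at t is a constant times the integral of W ds/s
over [t, q * t] (had_dilation_increment). The kernel of I^(1 - alpha) is
positive and decreases with the time lag. So, if k_q has a positive maximum at
(x0, t0), the increase of I^(1 - alpha) k_q at t0 is at least a constant times
k_q(x0, t0) (had_max_increment). Comparing the two gives
k_q(x0, t0) <= C * (W(x0, q * t0) - W(x0, max(1, t0))) (had_dilation_max).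

Space. The point x0 is interior, because W = - delta on the boundary, and it
maximizes the increment of H over [t0, q * t0], so that second differences of
this increment at x0 are at most 0. Integrating the equation over this interval
shows that w(x0, q * t0) - w(x0, t0) is at most of the order of q - 1 times the
oscillation of w at scale q - 1 (spatial_max). When t0 <= 1 the interval starts at t = 1, where
there is no equation, and a perturbation of the maximum point replaces the
argument (initial_max). This is dilation_bound.

Conclusion. If W were positive somewhere, then on an interval of times W would
be at least some m > 0 and I^(1 - alpha) k_q at least of order m * (q - 1), which
contradicts k_q <= o(q - 1) (gap_excess_le0). *)

(** * Substitution in integrals over open intervals *)

Lemma shrinking_itv_bigcup {R : realType} (a b : R) : a < b ->
  let r n := (b - a) / n.+3%:R in
  `]a, b[%classic = \bigcup_n `[a + r n, b - r n]%classic.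
Proof.
move=> ab r; have r0 n : 0 < r n by rewrite divr_gt0// subr_gt0.
apply/seteqP; split => x /=; last first.
  move=> [n _]; rewrite /= !in_itv/= => /andP[ax xb].
  by rewrite (lt_le_trans _ ax) ?ltrDl// (le_lt_trans xb)// gtrDl oppr_lt0.
rewrite in_itv/= => /andP[ax xb].
have m0 : 0 < Num.min (x - a) (b - x) by rewrite lt_min !subr_gt0 ax.
pose n := (Num.truncn ((b - a) / Num.min (x - a) (b - x))).
exists n => //=.
have : r n <= Num.min (x - a) (b - x).
  rewrite ler_pdivrMr// mulrC -ler_pdivrMr// /n.
  set y := _ / _.
  have y0 : 0 <= y by rewrite divr_ge0 ?ltW// subr_gt0.
  rewrite (le_trans (ltW (truncnS_gt y)))// ler_nat.
  exact: leq_trans (leqnSn _) (leqnSn _).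
rewrite le_min in_itv/= => /andP[]; lra.
Qed.

(** The derivative of the substitution is allowed to blow up at the end points,
as that of a power of the logarithm does: exhaust the open interval by the
compact intervals of the previous lemma, where the change of variables is
regular, and pass to the limit by monotone convergence on both sides. *)
Lemma ge0_integration_by_substitution_oo {R : realType} (F dF G : R -> R)
    (a b : R) : a < b ->
  {in `]a, b[, forall x, 0 < dF x} ->
  (forall x, x \in `]a, b[ -> is_derive x 1 F (dF x)) ->
  {in `]a, b[, continuous dF} ->
  {within `[a, b], continuous F} ->
  {in `]F a, F b[, continuous G} ->
  {in `]F a, F b[, forall x, 0 <= G x} ->
  (\int[lebesgue_measure]_(x in `]F a, F b[) (G x)%:E =
   \int[lebesgue_measure]_(x in `]a, b[) (G (F x) * dF x)%:E)%E.
Proof.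
move=> ab dF0 dFF cdF cF cG G0.
have incF : {in `[a, b] &, {homo F : x y / x < y}}.
  apply: gtr0_derive1_lt_cc => // x xab; first exact/ex_derive/dFF.
  by rewrite derive1E (derive_val (is_derive := dFF x xab)) dF0.
pose r n := (b - a) / n.+3%:R.
have r0 n : 0 < r n by rewrite divr_gt0// subr_gt0.
have rlt n : a + r n < b - r n.
  have n3 : n.+3%:R >= 3 :> R by rewrite ler_nat.
  suff : r n <= (b - a) / 3 by lra.
  rewrite /r ler_pM2l ?subr_gt0// lef_pV2// posrE; lra.
have inab n x : x \in `[a + r n, b - r n] -> x \in `]a, b[.
  rewrite !in_itv/= => /andP[h1 h2]; have := r0 n; lra.
have incc x : x \in `]a, b[ -> x \in `[a, b].
  by rewrite !in_itv/= => /andP[h1 h2]; rewrite !ltW.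
have aab : a \in `[a, b] by rewrite in_itv/= lexx ltW.
have bab : b \in `[a, b] by rewrite in_itv/= lexx ltW.
have FF x : x \in `]a, b[ -> F x \in `]F a, F b[.
  move=> xab; have /[!in_itv]/= /andP[ax xb] := xab.
  by apply/andP; split; apply: incF => //; exact: incc.
have lo n : a + r n \in `]a, b[ by apply: (inab n); rewrite in_itv/= lexx ltW.
have hi n : b - r n \in `]a, b[ by apply: (inab n); rewrite in_itv/= lexx ltW.
have incF' n : {in `[a + r n, b - r n] &, {homo F : x y / x < y}}.
  by move=> x y /inab/incc xi /inab/incc yi; exact: incF.
have E1 x : x \in `]a, b[ -> derive1 F x = dF x.
  by move=> /dFF h; rewrite derive1E; exact: derive_val.
have cF'x x : x \in `]a, b[ -> {for x, continuous (derive1 F)}.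
  move=> xab; have : dF y @[y --> x] --> derive1 F x by rewrite E1//; exact: cdF.
  apply: cvg_trans; apply: near_eq_cvg; near=> y; rewrite E1//.
  by near: y; exact: near_in_itvoo.
have cFx x : x \in `]a, b[ -> {for x, continuous F}.
  by move=> /dFF h; apply/differentiable_continuous/derivable1_diffP/ex_derive.
have sub n : (\int[lebesgue_measure]_(x in `[F (a + r n)%R, F (b - r n)%R]) (G x)%:E =
   \int[lebesgue_measure]_(x in `[(a + r n)%R, (b - r n)%R]) (G (F x) * dF x)%:E)%E.
  rewrite (@integration_by_substitution_increasing _ F G).
  - apply: eq_integral => x /[!inE] xi; congr (_%:E); rewrite -E1//; exact: inab xi.
  - by rewrite ltW.
  - exact: incF'.
  - move=> x xi; apply: cF'x; apply: (inab n).
    by move: xi; rewrite !in_itv/= => /andP[h1 h2]; rewrite !ltW.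
  - apply/cvg_ex; exists (derive1 F (a + r n)); apply: cvg_at_right_filter.
    exact: cF'x.
  - apply/cvg_ex; exists (derive1 F (b - r n)); apply: cvg_at_left_filter.
    exact: cF'x.
  - split.
    + move=> x xi; have /dFF h : x \in `]a, b[.
        apply: (inab n).
        by move: xi; rewrite !in_itv/= => /andP[h1 h2]; rewrite !ltW.
      exact: ex_derive.
    + by apply: cvg_at_right_filter; exact: cFx.
    + by apply: cvg_at_left_filter; exact: cFx.
  - apply: continuous_in_subspaceT => y; rewrite inE/= in_itv/= => /andP[y1 y2].
    have /[!in_itv]/= /andP[? ?] := FF _ (lo n).
    have /[!in_itv]/= /andP[? ?] := FF _ (hi n).
    apply: cG; rewrite in_itv/=; apply/andP; split; lra.
have rr m n : (m <= n)%N -> r n <= r m.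
  by move=> mn; rewrite /r ler_pM2l ?subr_gt0// lef_pV2 ?posrE// ler_nat.
have leF x y : x \in `]a, b[ -> y \in `]a, b[ -> x <= y -> F x <= F y.
  move=> /incc xi /incc yi; rewrite le_eqVlt => /predU1P[->//|xy].
  by rewrite ltW// incF.
have cupF : `]F a, F b[%classic = \bigcup_n `[F (a + r n), F (b - r n)]%classic.
  apply/seteqP; split => y /=; last first.
    move=> [n _] /=; rewrite !in_itv/= => /andP[y1 y2].
    have /[!in_itv]/= /andP[? ?] := FF _ (lo n).
    have /[!in_itv]/= /andP[? ?] := FF _ (hi n).
    apply/andP; split; lra.
  rewrite in_itv/= => /andP[y1 y2].
  have [|x xi xy] := IVT (ltW ab) cF (_ : Num.min (F a) (F b) <= y <= Num.max (F a) (F b)).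
    by rewrite ge_min le_max (ltW y1) (ltW y2) orbT.
  have xab : x \in `]a, b[.
    move: xi; rewrite !in_itv/= => /andP[].
    rewrite !le_eqVlt => /predU1P[ax|->].
      by move: y1; rewrite -xy ax ltxx.
    move=> /predU1P[bx|//].
    by move: y2; rewrite -xy bx ltxx.
  have : `]a, b[%classic x by [].
  rewrite shrinking_itv_bigcup// => -[n _] /= xn.
  exists n => //=; rewrite in_itv/= -xy.
  by move: (xn); rewrite in_itv/= => /andP[? ?]; rewrite !leF.
have mon1 : {homo (fun n => `[F (a + r n), F (b - r n)]%classic) : n m / (n <= m)%N >-> (n <= m)%O}.
  move=> n m nm; rewrite subsetEset; apply: subset_itv; rewrite bnd_simp leF//.
    by rewrite lerD2l rr.
  by rewrite lerD2l lerN2 rr.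
have mon2 : {homo (fun n => `[a + r n, b - r n]%classic) : n m / (n <= m)%N >-> (n <= m)%O}.
  move=> n m nm; rewrite subsetEset; apply: subset_itv; rewrite bnd_simp.
    by rewrite lerD2l rr.
  by rewrite lerD2l lerN2 rr.
have mG : measurable_fun `]F a, F b[ G.
  apply: open_continuous_measurable_fun; first exact: interval_open.
  by move=> x; rewrite inE; exact: cG.
have mGF : measurable_fun `]a, b[ (fun x => G (F x) * dF x).
  apply: open_continuous_measurable_fun; first exact: interval_open.
  move=> x; rewrite inE => xab; apply: cvgM; last exact: cdF.
  apply: (@continuous_comp _ _ _ F G); first exact: cFx.
  exact/cG/FF.
have itvF n : `[F (a + r n), F (b - r n)] `<=` `]F a, F b[.
  by rewrite cupF => x xn; exists n.
have itvab n : `[a + r n, b - r n] `<=` `]a, b[ by move=> x; exact: inab.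
have cvF : (\int[lebesgue_measure]_(x in `[F (a + r n)%R, F (b - r n)%R]) (G x)%:E
    @[n --> \oo] --> \int[lebesgue_measure]_(x in `]F a, F b[) (G x)%:E)%E.
  rewrite cupF; apply: ge0_nondecreasing_set_cvg_integral => //.
    move=> i; apply/measurable_EFinP; exact: measurable_funS mG.
  by move=> i x /itvF xi; rewrite lee_fin; exact: G0.
have cvab : (\int[lebesgue_measure]_(x in `[(a + r n)%R, (b - r n)%R]) (G (F x) * dF x)%:E
    @[n --> \oo] --> \int[lebesgue_measure]_(x in `]a, b[) (G (F x) * dF x)%:E)%E.
  have -> : `]a, b[%classic = \bigcup_n `[a + r n, b - r n]%classic.
    exact: shrinking_itv_bigcup.
  apply: ge0_nondecreasing_set_cvg_integral => //.
    move=> i; apply/measurable_EFinP; exact: measurable_funS mGF.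
  move=> i x /itvab xi; rewrite lee_fin mulr_ge0//; first exact/G0/FF.
  by rewrite ltW// dF0.
move: cvF; under eq_fun do rewrite sub; move=> cvF.
exact: cvg_unique cvF cvab.
Unshelve. all: end_near. Qed.

Lemma integral_itvoo_cst {R : realType} (c x y : R) : x < y ->
  (\int[lebesgue_measure]_(s in `]x, y[) c%:E = (c * (y - x))%:E)%E.
Proof.
move=> xy; rewrite integral_cst//.
transitivity (c%:E * lebesgue_measure (`]x, y[%classic : set R))%E => //.
by rewrite lebesgue_measure_itv/= lte_fin xy -EFinB -EFinM.
Qed.

(** * The kernel of the Hadamard integral *)

Lemma powR_continuous {R : realType} (r x : R) : 0 < x ->
  {for x, continuous (fun y : R => y `^ r)}.
Proof.
move=> x0; apply/differentiable_continuous/derivable1_diffP/derivable_powR.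
by rewrite in_itv/= x0.
Qed.

(** The truncation gives a power function with a positive exponent that is
continuous across 0; primitives of the kernel are built from it. *)
Lemma max0_powR_continuous {R : realType} (b : R) : 0 < b ->
  continuous (fun x : R => Num.max x 0 `^ b).
Proof.
move=> b0 x; have [x0|x0|->] := ltgtP x 0.
- have : (Num.max x 0 `^ b) @[_ --> x] --> Num.max x 0 `^ b by exact: cvg_cst.
  apply: cvg_trans; apply: near_eq_cvg; near=> y; rewrite !max_r// ltW//.
  by near: y; exact: lt_nbhsl.
- have : {for x, continuous (fun y : R => y `^ b)} by exact: powR_continuous.
  rewrite /continuous_at (max_l (ltW x0)).
  apply: cvg_trans; apply: near_eq_cvg; near=> y; rewrite max_l// ltW//.
  by near: y; exact: lt_nbhsr.
- rewrite /continuous_at maxxx powR0 ?gt_eqF//; apply/cvgrPdist_lt => e e0.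
  near=> y; rewrite sub0r normrN ger0_norm ?powR_ge0//.
  have [y0|y0] := leP y 0; first by rewrite powR0 ?gt_eqF.
  have -> : e = (e `^ b^-1) `^ b by rewrite -powRrM mulVf ?powRr1 ?gt_eqF// ltW.
  rewrite gt0_ltr_powR// ?nnegrE ?powR_ge0 ?(ltW y0)//.
  near: y; apply: lt_nbhsl; exact: powR_gt0.
Unshelve. all: end_near. Qed.

(** The factor 1/s of the invariant measure ds/s is part of the kernel, so that
the kernel for the order b = 1 is 1/s. *)
Definition hker {R : realType} (b t s : R) : R := ln (t / s) `^ (b - 1) / s.

Lemma hker_ge0 {R : realType} (b t s : R) : 0 <= s -> 0 <= hker b t s.
Proof. by move=> s0; rewrite divr_ge0// powR_ge0. Qed.

Lemma measurable_fun_hker {R : realType} (b t : R) :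
  measurable_fun (`]0, +oo[%classic : set R) (hker b t).
Proof.
apply: (@eq_measurable_fun _ _ _ _ _
    (fun s : R => ln (t * s `^ (-1)) `^ (b - 1) * s `^ (-1))).
  by move=> s; rewrite inE/= in_itv/= andbT => s0; rewrite /hker powR_inv1// ltW.
apply: measurable_funTS; apply: measurable_funM; last exact: measurable_powR.
apply: (measurableT_comp (measurable_powR _)).
apply: (measurableT_comp (@measurable_ln _)).
by apply: measurable_funM => //; exact: measurable_powR.
Qed.

Lemma hker_continuous {R : realType} (b t s : R) : 0 < s < t ->
  {for s, continuous (hker b t)}.
Proof.
move=> /andP[s0 st]; apply: cvgM; last by apply: cvgV; [rewrite gt_eqF|exact: cvg_id].
apply: (@continuous_comp _ _ _ (fun s : R => ln (t / s)) (fun x : R => x `^ (b - 1))).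
  apply: (@continuous_comp _ _ _ (fun s : R => t / s) (@ln R)).
    by apply: cvgM; [exact: cvg_cst|apply: cvgV; [rewrite gt_eqF|exact: cvg_id]].
  by apply: continuous_ln; rewrite divr_gt0// (lt_trans s0).
by apply: powR_continuous; rewrite ln_gt0// ltr_pdivlMr// mul1r.
Qed.

(** A primitive of the kernel in s is -ln(t/s)^b / b, which is continuous up to
s = t although the kernel is singular there when b < 1. *)
Lemma integral_hker {R : realType} (b a t : R) : 0 < b -> 0 < a -> a <= t ->
  (\int[lebesgue_measure]_(s in `[a, t]) (hker b t s)%:E =
   (ln (t / a) `^ b / b)%:E)%E.
Proof.
move=> b0 a0; rewrite le_eqVlt => /predU1P[at'|at'].
  by move: a0; rewrite at' => t0;
    rewrite set_itv1 integral_set1 divff ?ln1 ?powR0 ?mul0r// gt_eqF.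
have t0 : 0 < t by exact: lt_trans at'.
have inpos s : s \in `]a, t[ -> 0 < s < t.
  by rewrite in_itv/= => /andP[/(lt_trans a0) -> ->].
rewrite integral_itv_bndoo; last first.
  apply/measurable_EFinP; apply: measurable_funS (@measurable_fun_hker R b t) => //.
  by move=> s /= /inpos/andP[s0 _]; rewrite in_itv/= s0.
pose F s := - (b^-1 * Num.max (ln t - ln s) 0 `^ b).
have lnts s : 0 < s < t -> 0 < ln t - ln s.
  by move=> /andP[s0 st]; rewrite subr_gt0 ltr_ln.
have lnE s : 0 < s -> ln (t / s) = ln t - ln s by move=> s0; rewrite ln_div.
transitivity (\int[lebesgue_measure]_(s in `]a, t[) (cst 1 (F s) * hker b t s)%:E)%E.
  by apply: eq_integral => s _; rewrite mul1r.
transitivity (\int[lebesgue_measure]_(x in `]F a, F t[) (cst 1 x)%:E)%E; last first.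
  have Ft : F t = 0 by rewrite /F subrr maxxx powR0 ?gt_eqF// mulr0 oppr0.
  have Fa : F a = - (ln (t / a) `^ b / b).
    by rewrite /F lnE// max_l 1?mulrC// ltW// lnts ?a0.
  rewrite (integral_itvoo_cst 1) Ft Fa ?sub0r ?opprK ?mul1r//.
  by rewrite oppr_lt0 divr_gt0 ?powR_gt0 ?lnE ?lnts ?a0.
symmetry; apply: (@ge0_integration_by_substitution_oo R F (hker b t) (cst 1) a t at').
- move=> s /inpos/[dup] st /andP[s0 _]; rewrite divr_gt0// powR_gt0//.
  by rewrite lnE// lnts.
- move=> s /[dup] sat /inpos/[dup] st /andP[s0 s1].
  apply: (@near_eq_is_derive _ _ _ (fun s => - (b^-1 * (ln t - ln s) `^ b))).
    near=> y; rewrite /F max_l// ltW// lnts// (_ : y \in `]a, t[ -> 0 < y < t)//.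
      exact: inpos.
    by near: y; exact: near_in_itvoo.
  have dln := is_derive1_ln s0.
  have d1 : is_derive s 1 (fun s => ln t - ln s) (0 - s^-1).
    exact: is_deriveB.
  have d2 := @is_derive1_comp R (fun x => x `^ b) (fun s => ln t - ln s) s _ _
    (is_derive1_powR b (lnts _ st)) d1.
  have d3 : is_derive s 1 (fun s => - (b^-1 * (ln t - ln s) `^ b))
     (- (b^-1 *: (b * (ln t - ln s) `^ (b - 1) * (0 - s^-1)))).
    by apply: is_deriveN; apply: is_deriveZ.
  apply: (is_derive_eq d3); rewrite /hker lnE// sub0r mulrN scalerN opprK.
  by rewrite -[_ *: _]/(_ * _) !mulrA mulVf ?gt_eqF// mul1r.
- by move=> s /inpos st; exact: hker_continuous.
- apply: continuous_in_subspaceT => s; rewrite inE/= in_itv/= => /andP[s0 s1].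
  apply: cvgN; apply: cvgM; first exact: cvg_cst.
  apply: (@continuous_comp _ _ _ (fun s : R => ln t - ln s) (fun x : R => Num.max x 0 `^ b)); last exact: max0_powR_continuous.
  apply: cvgB; first exact: cvg_cst.
  by apply: continuous_ln; exact: lt_le_trans s0.
- by move=> x _; exact: cvg_cst.
- by move=> x _; exact: ler01.
Unshelve. all: end_near. Qed.

(** * The Hadamard integral of a continuous function *)

Lemma within_continuousP {R : realType} {T : pseudoMetricType R} (A : set T)
    (f : T -> R) :
  {within A, continuous f} <->
  forall x, A x -> forall e, 0 < e ->
    exists2 d, 0 < d & forall y, A y -> ball x d y -> `|f x - f y| < e.
Proof.
rewrite subspace_continuousP; split => cf x Ax.
  move=> e e0; have /cvgrPdist_lt/(_ _ e0) := cf x Ax.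
  rewrite near_withinE => /nbhs_ballP[d d0 xd]; exists d => // y Ay xy.
  exact: xd.
apply/cvgrPdist_lt => e e0; rewrite near_withinE.
have [d d0 xd] := cf x Ax e e0.
by apply/nbhs_ballP; exists d => // y xy Ay; exact: xd.
Qed.

(** Uniform continuity is stated with the ambient metric, not with the one
induced on A, because the closeness of points is always estimated in the whole
space. *)
Lemma compact_uniform_continuity {R : realType} {T : pseudoMetricType R}
    (A : set T) (f : T -> R) : compact A -> {within A, continuous f} ->
  forall e, 0 < e -> exists2 d, 0 < d &
    forall x y, A x -> A y -> ball x d y -> `|f x - f y| < e.
Proof.
move=> /compact_near_coveringP cA /within_continuousP cf e e0.
have := cA R (0^'+) (fun d x => A x -> forall y, A y -> ball x d y ->
  `|f x - f y| < e) _.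
case.
  move=> x Ax.
  have e20 : 0 < e / 2 by rewrite divr_gt0.
  have [d d0 xd] := cf x Ax _ e20.
  have d20 : 0 < d / 2 by rewrite divr_gt0.
  exists (ball x (d / 2), `]0, d / 2[%classic).
    split; first exact: nbhsx_ballx.
    exists (d / 2) => //= t. rewrite /= sub0r normrN => td t0.
    by rewrite in_itv/= t0 -(gtr0_norm t0).
  move=> [z t] [/= xz]; rewrite in_itv/= => /andP[t0 td] Az y Ay zy.
  rewrite -(subrKA (f x)) (le_lt_trans (ler_normD _ _))// (splitr e) ltrD//.
    rewrite distrC; apply: xd => //; apply: le_ball xz.
    by rewrite ler_pdivrMr// ler_peMr ?ler1n// ltW.
  apply: xd => //; rewrite (splitr d); apply: ball_triangle xz _.
  exact: le_ball (ltW td) _ zy.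
move=> d /= d0 H; exists (d / 2); first by rewrite divr_gt0.
move=> x y Ax Ay xy; apply: (H (d / 2) _ _ x Ax Ax y Ay xy) => /=.
  by rewrite sub0r normrN gtr0_norm ?divr_gt0// gtr_pMr// invf_lt1// ltr1n.
by rewrite divr_gt0.
Qed.

Lemma within_compM_continuous {R : realType} (q a b : R) (f : R -> R) : 0 < q ->
  {within `[q * a, q * b], continuous f} ->
  {within `[a, b], continuous (fun s => f (q * s))}.
Proof.
move=> q0 /within_continuousP cf; apply/within_continuousP => x.
rewrite /= in_itv/= => /andP[ax xb] e e0.
have [|d d0 h] := cf (q * x) _ e e0.
  by rewrite /= in_itv/= !ler_pM2l// ax.
exists (d / q); first by rewrite divr_gt0.
move=> y; rewrite /= in_itv/= => /andP[ay yb] xy; apply: h.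
  by rewrite /= in_itv/= !ler_pM2l// ay.
move: xy; rewrite /ball/= -mulrBr normrM gtr0_norm// ltr_pdivlMr//.
by rewrite mulrC.
Qed.

Lemma dilate_continuous {R : realType} {S : pseudoMetricType R} (X : set S)
    (q T : R) (v : S -> R -> R) : 1 < q ->
  {within X `*` `[q^-1, T], continuous (fun p => v p.1 p.2)} ->
  {within X `*` `[q^-1, T / q], continuous (fun p => v p.1 (q * p.2))}.
Proof.
move=> q1 /within_continuousP ch; have q0 : 0 < q by exact: lt_trans q1.
have qV0 : 0 < q^-1 by rewrite invr_gt0.
have I s : s \in `[q^-1, T / q] -> `[q^-1, T]%classic (q * s).
  rewrite /= !in_itv/= => /andP[s1 s2].
  rewrite [q * s]mulrC -ler_pdivlMr// s2 andbT.
  by rewrite (le_trans s1)// ler_peMr ?(ltW q1)// (le_trans _ s1)// ltW.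
apply/within_continuousP => -[y s] [/= Gy sI] e e0.
have [d d0 h] := ch (y, q * s) (conj Gy (I s sI)) e e0.
exists (d / q); first by rewrite divr_gt0.
move=> [z r] [/= Gz rI] [/= yz sr]; apply: (h (z, q * r)).
  by split => //; exact: I.
split => /=; first by apply: le_ball yz; rewrite ler_pdivrMr// ler_peMr// ltW.
by move: sr; rewrite /ball/= -mulrBr normrM gtr0_norm// ltr_pdivlMr// mulrC.
Qed.

Lemma compact_continuous_bounded {R : realType} {S : topologicalType} (A : set S)
    (f : S -> R) : compact A -> {within A, continuous f} ->
  exists2 N, 0 < N & forall x, A x -> `|f x| <= N.
Proof.
move=> cA cf; have /compact_bounded[M [_ h]] := continuous_compact cf cA.
exists (`|M| + 1); first by rewrite ltr_wpDl.
move=> x Ax; apply: (h (`|M| + 1)); last by exists x.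
by rewrite (le_lt_trans (ler_norm _))// ltrDl.
Qed.

(** The Hadamard integral of order b without the factor 1/Gamma(b). The base
point a is a parameter because a dilation of the time variable moves it. *)
HB.lock Definition had {R : realType} (b a : R) (f : R -> R) (t : R) : R :=
  \int[lebesgue_measure]_(s in `[a, t]) (hker b t s * f s).

Lemma hadE {R : realType} (b a : R) (f : R -> R) (t : R) :
  had b a f t = \int[lebesgue_measure]_(s in `[a, t]) (hker b t s * f s).
Proof. by rewrite unlock. Qed.

Lemma hadamard_intE {R : realType} (b : R) (f : R -> R) (t : R) :
  hadamard_int b f t = (Gamma b)^-1 * had b 1 f t.
Proof.
rewrite hadE; congr (_ * _); apply: eq_Rintegral => s _; by rewrite mulrAC.
Qed.

Section had.
Context {R : realType} (b a t : R) (b0 : 0 < b) (a0 : 0 < a).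
Implicit Types f g : R -> R.
Notation mu := (@lebesgue_measure R).

Let pos s : s \in `[a, t] -> 0 <= s.
Proof. by rewrite in_itv/= => /andP[/(lt_le_trans a0)/ltW]. Qed.

Lemma had_degenerate f : t <= a -> had b a f t = 0.
Proof.
rewrite le_eqVlt => /predU1P[->|ta].
  by rewrite hadE set_itv1 Rintegral_set1.
by rewrite hadE set_itv_ge ?Rintegral_set0// bnd_simp -ltNge.
Qed.

Lemma eq_had f g : {in `[a, t], f =1 g} -> had b a f t = had b a g t.
Proof. by move=> fg; rewrite !hadE; apply: eq_Rintegral => s; rewrite inE => /fg ->. Qed.

Lemma hker_integrable : mu.-integrable `[a, t] (EFin \o hker b t).
Proof.
have [at'|ta] := leP a t; last first.
  by rewrite set_itv_ge ?bnd_simp -?ltNge//; exact: integrable_set0.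
apply/integrableP; split.
  apply/measurable_EFinP; apply: measurable_funS (@measurable_fun_hker R b t) => //.
  move=> s /=; rewrite !in_itv/= => /andP[as_ _].
  by rewrite (lt_le_trans a0).
suff -> : (\int[mu]_(s in `[a, t]) `|(EFin \o hker b t) s| =
  \int[mu]_(s in `[a, t]) (hker b t s)%:E)%E by rewrite integral_hker// ltry.
by apply: eq_integral => s /[!inE] sat /=; rewrite ger0_norm// hker_ge0// pos.
Qed.

Lemma had_integrable f : {within `[a, t], continuous f} ->
  mu.-integrable `[a, t] (EFin \o (fun s => hker b t s * f s)).
Proof.
move=> cf; have [N _ Nf] := compact_continuous_bounded _ _ (@segment_compact R _ _) cf.
apply: (integrableMl _ hker_integrable) => //.
  exact: subspace_continuous_measurable_fun.
exists N; split; first exact: num_real.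
by move=> M NM s /= /Nf /le_trans; apply; exact: ltW.
Qed.

Lemma had_cst c : a <= t -> had b a (cst c) t = c * (ln (t / a) `^ b / b).
Proof.
move=> at'; rewrite hadE RintegralZr//; last exact: hker_integrable.
by rewrite mulrC {1}/Rintegral integral_hker.
Qed.

Lemma hadB f g : {within `[a, t], continuous f} ->
  {within `[a, t], continuous g} ->
  had b a (fun s => f s - g s) t = had b a f t - had b a g t.
Proof.
move=> cf cg; rewrite !hadE -RintegralB//; try exact: had_integrable.
by apply: eq_Rintegral => s _; rewrite mulrBr.
Qed.

Lemma hadD f g : {within `[a, t], continuous f} ->
  {within `[a, t], continuous g} ->
  had b a (fun s => f s + g s) t = had b a f t + had b a g t.
Proof.
move=> cf cg; rewrite !hadE -RintegralD//; try exact: had_integrable.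
by apply: eq_Rintegral => s _; rewrite mulrDr.
Qed.

Lemma had_le f g : {within `[a, t], continuous f} ->
  {within `[a, t], continuous g} ->
  {in `[a, t], forall s, f s <= g s} -> had b a f t <= had b a g t.
Proof.
move=> cf cg fg; rewrite !hadE; apply: le_Rintegral => //; try exact: had_integrable.
by move=> s sat; rewrite ler_wpM2l ?fg// hker_ge0// pos.
Qed.

Lemma had_norm_le f N : a <= t -> {within `[a, t], continuous f} ->
  {in `[a, t], forall s, `|f s| <= N} ->
  `|had b a f t| <= N * (ln (t / a) `^ b / b).
Proof.
move=> at' cf fN; rewrite -had_cst// ler_norml.
have c0 c : {within `[a, t], continuous (cst c : R -> R)}.
  by apply: continuous_subspaceT => ?; exact: cvg_cst.
have -> : - had b a (cst N) t = had b a (cst (- N)) t by rewrite !had_cst// mulNr.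
by rewrite !had_le// => s /fN; rewrite ler_norml => /andP[].
Qed.

Lemma EFin_had f : {within `[a, t], continuous f} ->
  (had b a f t)%:E = (\int[mu]_(s in `[a, t]) (hker b t s * f s)%:E)%E.
Proof.
move=> cf; rewrite hadE /Rintegral fineK//.
exact: (integrable_fin_num _ (had_integrable _ cf)).
Qed.

End had.

Lemma cst_within_continuous {R : realType} (c : R) (A : set R) :
  {within A, continuous (cst c : R -> R)}.
Proof. by apply: continuous_subspaceT => ?; exact: cvg_cst. Qed.

Lemma had_addr {R : realType} (b a t N : R) (f : R -> R) :
  0 < b -> 0 < a -> a <= t -> {within `[a, t], continuous f} ->
  had b a (fun s => f s + N) t = had b a f t + N * (ln (t / a) `^ b / b).
Proof.
move=> b0 a0 at' cf; rewrite -(had_cst _ _ _ b0 a0 N at').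
exact: (hadD _ _ _ b0 a0 f (cst N) cf (cst_within_continuous _ _)).
Qed.

Lemma measurable_fun_hkerM {R : realType} (b a t : R) (f : R -> R) : 0 < a ->
  {within `[a, t], continuous f} ->
  measurable_fun (`]a, t[%classic : set R) (fun s => hker b t s * f s).
Proof.
move=> a0 cf; apply: measurable_funM.
  apply: measurable_funS (@measurable_fun_hker R b t) => // s /=.
  by rewrite !in_itv/= => /andP[/(lt_trans a0) ->].
apply: (@measurable_funS _ _ _ _ (`[a, t]%classic : set R)) => //.
  by apply: subset_itv; rewrite bnd_simp.
exact: subspace_continuous_measurable_fun.
Qed.

(** The kernel and the measure ds/s depend on ratios only, so that the
substitution s -> q * s carries the integral over [a, t] to the one over
[q * a, q * t]. The sign of f makes monotone convergence applicable. *)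
Lemma had_scale_ge0 {R : realType} (b a q t : R) (f : R -> R) :
  0 < b -> 0 < a -> 0 < q -> a < t -> {within `[q * a, q * t], continuous f} ->
  {in `[q * a, q * t], forall s, 0 <= f s} ->
  had b (q * a) f (q * t) = had b a (fun s => f (q * s)) t.
Proof.
move=> b0 a0 q0 at' cf f0.
have t0 := lt_trans a0 at'.
have qat : q * a < q * t by rewrite ltr_pM2l.
have qa0 : 0 < q * a by rewrite mulr_gt0.
have cf' := within_compM_continuous _ _ _ _ q0 cf.
apply: EFin_inj; rewrite !EFin_had//.
rewrite integral_itv_bndoo; last first.
  by apply/measurable_EFinP; apply: measurable_fun_hkerM.
rewrite [RHS]integral_itv_bndoo; last first.
  by apply/measurable_EFinP; apply: measurable_fun_hkerM.
pose F s : R := q * s.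
have sub s : s \in `]q * a, q * t[ -> s \in `[q * a, q * t].
  by apply: subset_itv; rewrite bnd_simp.
transitivity (\int[lebesgue_measure]_(s in `]a, t[)
    (hker b (q * t) (F s) * f (F s) * (cst q s))%:E)%E.
  apply: (@ge0_integration_by_substitution_oo R F (cst q)
    (fun s => hker b (q * t) s * f s) a t at').
  - by move=> s _.
  - move=> s _; have d : is_derive s 1 F (q *: 1).
      exact: (is_deriveZ q (is_derive_id s 1)).
    by apply: (is_derive_eq d); exact: mulr1.
  - by move=> s _; exact: cvg_cst.
  - by apply: continuous_subspaceT => s; apply: mulrl_continuous.
  - move=> s sI; apply: cvgM.
      apply: hker_continuous; move: sI; rewrite in_itv/= => /andP[+ ->].
      by move/(lt_trans qa0) => ->.
    exact: (within_continuous_continuous qat cf sI).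
  - move=> s sI; rewrite mulr_ge0//; last exact/f0/sub.
    rewrite hker_ge0//; move: sI; rewrite in_itv/= => /andP[+ _].
    by move/(lt_trans qa0)/ltW.
apply: eq_integral => s; rewrite inE/= in_itv/= => /andP[as_ st].
congr EFin; rewrite /F /hker /= -mulf_div divff ?mul1r ?gt_eqF//.
have s0 : s != 0 by rewrite gt_eqF// (lt_trans a0).
field; by rewrite s0 gt_eqF.
Qed.

(** Adding a constant to f reduces the general case to a nonnegative one, since
the integral of a constant is explicit on both sides. *)
Lemma had_scale {R : realType} (b a q t : R) (f : R -> R) :
  0 < b -> 0 < a -> 0 < q -> {within `[q * a, q * t], continuous f} ->
  had b (q * a) f (q * t) = had b a (fun s => f (q * s)) t.
Proof.
move=> b0 a0 q0 cf.
have [at'|ta] := ltP a t; last by rewrite !had_degenerate// ler_pM2l.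
have qat : q * a <= q * t by rewrite ler_pM2l// ltW.
have qa0 : 0 < q * a by rewrite mulr_gt0.
have cf' := within_compM_continuous _ _ _ _ q0 cf.
have [N _ Nf] := compact_continuous_bounded _ _ (@segment_compact R _ _) cf.
have cfN : {within `[q * a, q * t], continuous (fun s => f s + N)}.
  by move=> x; apply: cvgD; [exact: cf|exact: cst_within_continuous].
have := had_scale_ge0 b a q t (fun s => f s + N) b0 a0 q0 at' cfN.
rewrite (had_addr _ _ _ N _ b0 qa0 qat cf) (had_addr _ _ _ N _ b0 a0 (ltW at') cf').
rewrite -mulf_div divff ?mul1r ?gt_eqF//.
move=> /(_ _)/addIr; apply => s /Nf; rewrite ler_norml => /andP[+ _].
by rewrite -subr_ge0 opprK.
Qed.

Lemma had_split {R : realType} (b a c t : R) (f : R -> R) :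
  0 < b -> 0 < a -> a <= c -> c <= t -> {within `[a, t], continuous f} ->
  had b a f t =
  \int[lebesgue_measure]_(s in `[a, c]) (hker b t s * f s) + had b c f t.
Proof.
move=> b0 a0 ac ct cf.
have int := had_integrable b a t b0 a0 f cf.
apply/eqP; rewrite addrC -subr_eq; apply/eqP.
rewrite !hadE Rintegral_itvB// ?bnd_simp// Rintegral_itv_obnd_cbnd//.
apply: integrableS int => //; apply: subset_itv; by rewrite bnd_simp.
Qed.

(** Dilating the integral at s to the end point t, with the ratio q = t / s,
gives both integrals the same kernel. The dilated one starts at 1/q: the part
from 1/q to 1 is bounded through the bound on f, the rest through the
variation of f under the dilation. *)
Lemma had_increment {R : realType} (b s t N w : R) (f : R -> R) :
  0 < b -> 1 <= s -> s <= t -> {within `[1, t], continuous f} ->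
  {in `[1, t], forall x, `|f x| <= N} ->
  {in `[1, s], forall x, `|f (t / s * x) - f x| <= w} ->
  `|had b 1 f t - had b 1 f s| <=
  N * ((ln t `^ b - ln s `^ b) / b) + w * (ln s `^ b / b).
Proof.
move=> b0 s1 st cf fN fw.
have s0 : 0 < s by exact: lt_le_trans s1.
have [q [qE q0 q1 qs]] : exists q, [/\ q = t / s, 0 < q, 1 <= q & q * s = t].
  have q1 : 1 <= t / s by rewrite ler_pdivlMr// mul1r.
  by exists (t / s); split=> //; [exact: lt_le_trans q1|rewrite divfK// gt_eqF].
rewrite -qE in fw.
have qVq : q * q^-1 = 1 by rewrite divff// gt_eqF.
have qV0 : 0 < q^-1 by rewrite invr_gt0.
have qV1 : q^-1 <= 1 by rewrite invf_le1.
have cfq : {within `[q * q^-1, q * s], continuous f} by rewrite qVq qs.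
have cg := within_compM_continuous _ _ _ _ q0 cfq.
have E := had_scale b q^-1 q s f b0 qV0 q0 cfq.
rewrite qVq qs in E; rewrite {}E.
have cg1 : {within `[1, s], continuous (fun x => f (q * x))}.
  by apply: continuous_subspaceW cg; apply: subset_itv; rewrite bnd_simp.
have cfs : {within `[1, s], continuous f}.
  by apply: continuous_subspaceW cf; apply: subset_itv; rewrite bnd_simp.
have -> := had_split b q^-1 1 s (fun x => f (q * x)) b0 qV0 qV1 s1 cg.
rewrite -addrA -(hadB b 1 s b0 ltr01 (fun x => f (q * x)) f cg1 cfs).
rewrite (le_trans (ler_normD _ _))// lerD//; last first.
  rewrite -[X in ln X `^ b / b](divr1 s); apply: had_norm_le => //.
  by move=> x; apply: cvgB; [exact: cg1|exact: cfs].
have intc (g : R -> R) : {within `[q^-1, s], continuous g} ->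
    lebesgue_measure.-integrable `[q^-1, 1] (EFin \o (fun x => hker b s x * g x)).
  move=> /(had_integrable b _ _ b0 qV0); apply: integrableS => //.
  by apply: subset_itv; rewrite bnd_simp.
have -> : N * ((ln t `^ b - ln s `^ b) / b) =
    \int[lebesgue_measure]_(x in `[q^-1, 1]) (hker b s x * cst N x).
  apply: (addIr (had b 1 (cst N) s)).
  have <- := had_split b q^-1 1 s (cst N) b0 qV0 qV1 s1 (cst_within_continuous _ _).
  rewrite !had_cst//; last exact: le_trans s1.
  by rewrite invrK divr1 [s * q]mulrC qs -mulrDr -mulrDl subrK.
rewrite (le_trans (le_normr_Rintegral _ _))//.
  exact: (intc _ cg).
apply: le_Rintegral => //.
- have := intc _ cg => /integrable_norm; apply: eq_integrable => // x _.
- exact: intc (cst_within_continuous _ _).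
move=> x; rewrite /= in_itv/= => /andP[qx x1].
have x0 : 0 <= x by rewrite (le_trans _ qx)// ltW.
rewrite normrM ger0_norm ?hker_ge0// ler_wpM2l ?hker_ge0// fN//.
rewrite in_itv/= -(qs) ler_pM2l// (le_trans x1)// andbT.
by rewrite -(ler_pM2l q0) divff// gt_eqF in qx.
Qed.

Lemma ln_powR_within_continuous {R : realType} (b T : R) : 0 < b ->
  {within `[1, T], continuous (fun t : R => ln t `^ b)}.
Proof.
move=> b0.
apply: (@subspace_eq_continuous _ _ _ (fun t : R => Num.max (ln t) 0 `^ b)).
  move=> t; rewrite inE/= in_itv/= => /andP[t1 _].
  by rewrite /from_subspace/= max_l// ln_ge0.
apply: continuous_in_subspaceT => t; rewrite inE/= in_itv/= => /andP[t1 _].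
apply: (@continuous_comp _ _ _ (@ln R) (fun x : R => Num.max x 0 `^ b)).
  by apply: continuous_ln; exact: lt_le_trans t1.
exact: max0_powR_continuous.
Qed.

Lemma had_continuous {R : realType} (b T : R) (f : R -> R) :
  0 < b -> {within `[1, T], continuous f} ->
  {within `[1, T], continuous (had b 1 f)}.
Proof.
move=> b0 cf; apply/within_continuousP => t0 t0T e e0.
have [N0 _ fN0] := compact_continuous_bounded _ _ (@segment_compact R _ _) cf.
pose N := `|N0| + 1.
have N_gt0 : 0 < N by rewrite ltr_wpDl.
have fN s : s \in `[1, T] -> `|f s| <= N.
  by move=> /fN0/le_trans; apply; rewrite (le_trans (ler_norm _))// lerDl.
pose L := ln T `^ b / b.
have L0 : 0 <= L by rewrite divr_ge0 ?powR_ge0// ltW.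
have w0 : 0 < e / 2 / (L + 1) by rewrite !divr_gt0// ltr_wpDl.
have [d1 d10 ucf] := compact_uniform_continuity _ _ (@segment_compact R 1 T) cf _ w0.
have cln := (within_continuousP _ _).1 (ln_powR_within_continuous b T b0) t0 t0T.
have v0 : 0 < e / 2 / N * b by rewrite mulr_gt0// !divr_gt0.
have [d2 d20 cln2] := cln _ v0.
have key s t : s <= t -> s \in `[1, T] -> t \in `[1, T] -> t - s < d1 ->
    `|ln t `^ b - ln s `^ b| < e / 2 / N * b ->
    `|had b 1 f t - had b 1 f s| < e.
  move=> st /[!in_itv]/= /andP[s1 sT] /andP[t1 tT] tsd lnd.
  have s0 : 0 < s by exact: lt_le_trans s1.
  have tsE : t / s * s = t by rewrite divfK// gt_eqF.
  apply: le_lt_trans (@had_increment R b s t N (e / 2 / (L + 1)) f _ _ _ _ _ _) _ => //.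
  - by apply: continuous_subspaceW cf; apply: subset_itv; rewrite bnd_simp.
  - move=> x /[!in_itv]/= /andP[x1 xt]; apply: fN.
    by rewrite in_itv/= x1 (le_trans xt).
  - move=> x /[!in_itv]/= /andP[x1 xs]; apply/ltW/ucf.
    + rewrite /= in_itv/=; apply/andP; split.
        by rewrite -[leLHS]mulr1 ler_pM// ler_pdivlMr// mul1r.
      rewrite (le_trans _ tT)// -[leRHS]tsE ler_wpM2l//.
      by rewrite divr_ge0// ltW// (lt_le_trans s0).
    + by rewrite /= in_itv/= x1 (le_trans xs).
    + rewrite /ball/= -[X in _ - X]mul1r -mulrBl ger0_norm; last first.
        rewrite mulr_ge0 ?(le_trans _ x1)// subr_ge0 ler_pdivlMr// mul1r//.
      apply: le_lt_trans tsd; rewrite -[in leRHS]tsE.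
      rewrite -[X in _ <= _ - X]mul1r -mulrBl ler_wpM2l// subr_ge0.
      by rewrite ler_pdivlMr// mul1r.
  rewrite [ltRHS]splitr ltr_leD//.
    rewrite (le_lt_trans (_ : _ <= N * (`|ln t `^ b - ln s `^ b| / b)))//.
      by rewrite ler_wpM2l ?(ltW N_gt0)// ler_pM2r ?invr_gt0// ler_norm.
    by rewrite mulrC -ltr_pdivlMr// ltr_pdivrMr.
  have L1 : 0 < L + 1 by rewrite ltr_wpDl.
  apply: (@le_trans _ _ (e / 2 / (L + 1) * (L + 1))); last first.
    by rewrite divfK// gt_eqF.
  apply: ler_wpM2l; first exact: ltW.
  rewrite (@le_trans _ _ L) ?lerDl//.
  rewrite /L ler_pM2r ?invr_gt0//.
  have T0 : 0 < T by exact: lt_le_trans s0 sT.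
  apply: (ge0_ler_powR (ltW b0)); rewrite ?nnegrE.
  - exact: ln_ge0.
  - by rewrite ln_ge0// (le_trans s1).
  - by rewrite ler_ln.
exists (Num.min d1 d2); first by rewrite lt_min d10.
move=> y yT t0y; have [yd1 yd2] : `|t0 - y| < d1 /\ `|t0 - y| < d2.
  by move: t0y; rewrite /ball/= lt_min => /andP[].
have lnd := cln2 y yT yd2.
have [ty|yt] := leP t0 y.
  rewrite distrC; apply: key => //; last by rewrite distrC.
  by rewrite (le_lt_trans _ yd1)// distrC ler_norm.
by apply: key => //; [exact: ltW|rewrite (le_lt_trans _ yd1)// ler_norm].
Qed.

(** * The semigroup property for the orders b and 1 - b *)

Section semigroup.
Context {R : realType} (b : R) (b01 : 0 < b < 1).
Notation mu := (@lebesgue_measure R).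

Let b0 : 0 < b. Proof. by case/andP: b01. Qed.
Let b'0 : 0 < 1 - b. Proof. by rewrite subr_gt0; case/andP: b01. Qed.

Definition beta_integrand (y : R) : R := y `^ (b - 1) * (1 - y) `^ (1 - b - 1).

(** The Beta integral B(b, 1 - b). Its finiteness comes out of the semigroup
identity, hence the value in the extended reals. *)
Definition beta_integral : \bar R :=
  (\int[mu]_(y in `]0%R, 1%R[) (beta_integrand y)%:E)%E.

Lemma beta_integrand_continuous : {in `]0, 1[, continuous beta_integrand}.
Proof.
move=> y; rewrite in_itv/= => /andP[y0 y1]; apply: cvgM.
  exact: powR_continuous.
apply: (@continuous_comp _ _ _ (fun x : R => 1 - x) (fun x : R => x `^ (1 - b - 1))).
  by apply: cvgB; [exact: cvg_cst|exact: cvg_id].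
by apply: powR_continuous; rewrite subr_gt0.
Qed.

Lemma beta_integrand_ge1 : {in `]0, 1[, forall y, 1 <= beta_integrand y}.
Proof.
move=> y; rewrite in_itv/= => /andP[y0 y1].
have pow1 x r : 0 < x <= 1 -> r <= 0 -> 1 <= x `^ r.
  by move=> x01 r0; rewrite -(powRr0 x) ger_powR.
have [h1 h2] := (b0, b'0).
rewrite -[leLHS]mulr1 ler_pM//; apply: pow1.
- by rewrite y0 ltW.
- by rewrite subr_le0; lra.
- by rewrite subr_gt0 y1; lra.
- lra.
Qed.

Lemma beta_integral_ge1 : (1 <= beta_integral)%E.
Proof.
have -> : (1 = \int[mu]_(y in `]0%R, 1%R[) 1%:E :> \bar R)%E.
  by rewrite integral_itvoo_cst// subr0 mulr1.
apply: ge0_le_integral => //.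
- apply/measurable_EFinP; apply: open_continuous_measurable_fun => //.
  by move=> y; rewrite inE; exact: beta_integrand_continuous.
- by move=> y; rewrite /= => /beta_integrand_ge1; rewrite lee_fin.
Qed.

(** The substitution y = ln(s/x) / ln(t/x) turns the integral into the Beta
integral. It does not depend on x and t because the two exponents b - 1 and -b
add up to -1, which compensates the factor of the substitution. *)
Lemma integral_hker_hker (x t : R) : 0 < x -> x < t ->
  (\int[mu]_(s in `]x, t[) (hker (1 - b) t s * ln (s / x) `^ (b - 1))%:E
   = beta_integral)%E.
Proof.
move=> x0 xt; have t0 := lt_trans x0 xt.
pose L := ln t - ln x.
have L0 : 0 < L by rewrite subr_gt0 ltr_ln.
pose F (s : R) := L^-1 * (ln s - ln x).
have inpos s : s \in `]x, t[ -> 0 < s.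
  by rewrite in_itv/= => /andP[/(lt_trans x0)].
have F0 : F x = 0 by rewrite /F subrr mulr0.
have F1 : F t = 1 by rewrite /F mulVf// gt_eqF.
have -> : (beta_integral =
    \int[mu]_(y in `]F x, F t[) (beta_integrand y)%:E)%E by rewrite F0 F1.
symmetry.
transitivity (\int[mu]_(s in `]x, t[)
    (beta_integrand (F s) * (L^-1 * s^-1))%:E)%E.
  apply: (@ge0_integration_by_substitution_oo R F (fun s => L^-1 * s^-1)
    beta_integrand x t xt).
  - by move=> s /inpos s0; rewrite mulr_gt0// invr_gt0.
  - move=> s /inpos s0.
    have dln := is_derive1_ln s0.
    have d1 : is_derive s 1 (fun s => ln s - ln x) (s^-1 - 0).
      exact: is_deriveB.
    have d : is_derive s 1 F (L^-1 *: (s^-1 - 0)) by exact: is_deriveZ.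
    by apply: (is_derive_eq d); rewrite subr0.
  - move=> s /inpos s0; apply: cvgM; first exact: cvg_cst.
    by apply: cvgV; [rewrite gt_eqF|exact: cvg_id].
  - apply: continuous_in_subspaceT => s; rewrite inE/= in_itv/= => /andP[s0 s1].
    apply: cvgM; first exact: cvg_cst.
    apply: cvgB; last exact: cvg_cst.
    by apply: continuous_ln; exact: lt_le_trans s0.
  - by rewrite F0 F1; exact: beta_integrand_continuous.
  - move=> y; rewrite F0 F1 => /beta_integrand_ge1.
    exact: le_trans.
apply: eq_integral => s; rewrite inE/= => sI; congr EFin.
have s0 := inpos _ sI; move: sI; rewrite in_itv/= => /andP[xs st].
rewrite /beta_integrand /hker !ln_div//.
have -> : 1 - F s = L^-1 * (ln t - ln s).
  rewrite /F /L; field; by rewrite gt_eqF.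
have A0 : 0 <= ln s - ln x by rewrite subr_ge0 ler_ln// ltW.
have B0 : 0 <= ln t - ln s by rewrite subr_ge0 ler_ln// ltW.
have LV0 : 0 <= L^-1 by rewrite invr_ge0 ltW.
rewrite !powRM//.
have E : L^-1 `^ (b - 1) * L^-1 `^ (1 - b - 1) = L.
  rewrite -powRD; last by rewrite invr_eq0 (gt_eqF L0) implybT.
  have -> : b - 1 + (1 - b - 1) = - 1 :> R by ring.
  by rewrite powR_inv1// invrK.
have LV : L * L^-1 = 1 by rewrite mulfV// gt_eqF.
transitivity ((L^-1 `^ (b - 1) * L^-1 `^ (1 - b - 1)) * L^-1 *
  ((ln t - ln s) `^ (1 - b - 1) / s * (ln s - ln x) `^ (b - 1))); first by ring.
by rewrite E LV mul1r.
Qed.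

Section tonelli.
Variables (t : R) (f : R -> R) (t1 : 1 < t).
Hypotheses (cf : {within `[1, t], continuous f})
           (f0 : {in `[1, t], forall s, 0 <= f s}).

(* The integrand on the triangle 1 < x < s < t, with z = (s, x). Writing the
   inverses as powers makes its measurability on the whole plane immediate. *)
Let A (z : R * R) : R :=
  ln (t * z.1 `^ (-1)) `^ (1 - b - 1) * z.1 `^ (-1) *
  (ln (z.1 * z.2 `^ (-1)) `^ (b - 1) * z.2 `^ (-1) * (f \_ `]1, t[) z.2).

Let g (z : R * R) : \bar R :=
  if [&& 1 < z.2, z.2 < z.1 & z.1 < t] then (A z)%:E else 0%E.

Let fpatch : measurable_fun setT (f \_ `]1, t[ : R -> R).
Proof.
apply/(measurable_restrictT _ (measurable_itv _)).
apply: (@measurable_funS _ _ _ _ (`[1, t]%classic : set R)) => //.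
  by apply: subset_itv; rewrite bnd_simp.
exact: subspace_continuous_measurable_fun.
Qed.

Let mA : measurable_fun setT A.
Proof.
have m1 : measurable_fun setT (fun z : R * R => z.1) by exact: measurable_fst.
have m2 : measurable_fun setT (fun z : R * R => z.2) by exact: measurable_snd.
have i1 : measurable_fun setT (fun z : R * R => z.1 `^ (-1)).
  exact: (measurableT_comp (measurable_powR _)).
have i2 : measurable_fun setT (fun z : R * R => z.2 `^ (-1)).
  exact: (measurableT_comp (measurable_powR _)).
apply: measurable_funM; apply: measurable_funM => //.
- apply: (measurableT_comp (measurable_powR _)).
  apply: (measurableT_comp (@measurable_ln R)).
  exact: measurable_funM.
- apply: measurable_funM => //.
  apply: (measurableT_comp (measurable_powR _)).
  apply: (measurableT_comp (@measurable_ln R)).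
  exact: measurable_funM.
- exact: (measurableT_comp fpatch).
Qed.

Let mg : measurable_fun setT g.
Proof.
apply: measurable_fun_ifT => //; last exact/measurable_EFinP.
apply: measurable_and; [|apply: measurable_and]; apply: measurable_fun_ltr => //.
Qed.

Let AE s x : 1 < x -> x < s -> s < t ->
  A (s, x) = hker (1 - b) t s * (hker b s x * f x).
Proof.
move=> x1 xs st; have x0 : 0 < x by exact: lt_trans x1.
have s0 := lt_trans x0 xs.
rewrite /A /= !powR_inv1 ?ltW// patchE ifT//.
by rewrite inE/= in_itv/= x1 (lt_trans xs).
Qed.

Let g0 z : (0 <= g z)%E.
Proof.
case: z => s x; rewrite /g/=; case: ifPn => // /and3P[x1 xs st].
have x0 : 0 < x by exact: lt_trans x1.
have s0 : 0 <= s by rewrite ltW// (lt_trans x0).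
rewrite AE// lee_fin; apply: mulr_ge0; first exact: hker_ge0.
apply: mulr_ge0; first by apply: hker_ge0; exact: ltW.
by apply: f0; rewrite in_itv/= !ltW// (lt_trans xs).
Qed.

Lemma tonelli_had :
  (\int[mu]_(s in `]1%R, t[) (hker (1 - b) t s * had b 1 f s)%:E =
   beta_integral * \int[mu]_(x in `]1%R, t[) (f x / x)%:E)%E.
Proof.
transitivity (\int[mu]_s \int[mu]_x g (s, x))%E.
  rewrite integral_mkcond; apply: eq_integral => s _; rewrite patchE.
  case: ifPn => [|sI]; last first.
    rewrite integral0_eq// => x _; rewrite /g/=; case: ifPn => // /and3P[x1 xs st].
    by move: sI; rewrite notin_setE/= in_itv/= (lt_trans x1) ?st.
  rewrite inE/= in_itv/= => /andP[s1 st].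
  have cfs : {within `[1, s], continuous f}.
    by apply: continuous_subspaceW cf; apply: subset_itv; rewrite bnd_simp// ltW.
  have fs0 x : x \in `]1, s[ -> 0 <= f x.
    rewrite in_itv/= => /andP[x1 xs]; apply: f0; rewrite in_itv/= !ltW//.
    exact: lt_trans st.
  have mh := measurable_fun_hkerM b 1 s f ltr01 cfs.
  rewrite EFinM (EFin_had b 1 s b0 ltr01 f cfs).
  rewrite integral_itv_bndoo; last exact/measurable_EFinP.
  rewrite -ge0_integralZl_EFin//; last 3 first.
  - move=> x; rewrite /= => xI; rewrite lee_fin mulr_ge0 ?fs0// hker_ge0//.
    by move: xI; rewrite in_itv/= => /andP[/(lt_trans ltr01)/ltW].
  - exact/measurable_EFinP.
  - by rewrite hker_ge0// ltW// (lt_trans _ s1).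
  rewrite integral_mkcond; apply: eq_integral => x _; rewrite patchE /g/=.
  rewrite mem_setE in_itv/= st andbT; case: ifPn => // /andP[x1 xs].
  by rewrite AE.
transitivity (\int[mu]_x \int[mu]_s g (s, x))%E.
  exact: (@fubini_tonelli _ _ _ _ R mu mu g mg g0).
rewrite -ge0_integralZl//; last 3 first.
- apply/measurable_EFinP; apply: measurable_funM.
    apply: (@measurable_funS _ _ _ _ (`[1, t]%classic : set R)) => //.
      by apply: subset_itv; rewrite bnd_simp.
    exact: subspace_continuous_measurable_fun.
  apply: (@eq_measurable_fun _ _ _ _ _ (fun x : R => x `^ (-1))).
    move=> x; rewrite inE/= in_itv/= => /andP[x1 _].
    by rewrite powR_inv1// ltW// (lt_trans _ x1).
  by apply: measurable_funTS; exact: measurable_powR.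
- move=> x; rewrite /= in_itv/= => /andP[x1 xt]; rewrite lee_fin divr_ge0//.
    by rewrite f0// in_itv/= !ltW.
  by rewrite ltW// (lt_trans _ x1).
- exact: le_trans beta_integral_ge1.
rewrite [RHS]integral_mkcond; apply: eq_integral => x _; rewrite patchE.
case: ifPn => [|xI]; last first.
  rewrite integral0_eq// => s _; rewrite /g/=; case: ifPn => // /and3P[x1 xs st].
  by move: xI; rewrite notin_setE/= in_itv/= (lt_trans xs) ?x1.
rewrite inE/= in_itv/= => /andP[x1 xt].
have x0 : 0 < x by exact: lt_trans x1.
have fx0 : 0 <= f x / x.
  by apply: divr_ge0; [apply: f0; rewrite in_itv/= !ltW|exact: ltW].
rewrite -(integral_hker_hker _ _ x0 xt) muleC.
rewrite -ge0_integralZl_EFin//; last 2 first.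
- move=> s; rewrite /= in_itv/= => /andP[xs st].
  by rewrite lee_fin mulr_ge0 ?powR_ge0// hker_ge0// ltW// (lt_trans x0).
- apply/measurable_EFinP; apply: open_continuous_measurable_fun => //.
  move=> s; rewrite inE/= in_itv/= => /andP[xs st].
  apply: cvgM; first by apply: hker_continuous; rewrite (lt_trans x0).
  apply: (@continuous_comp _ _ _ (fun s : R => ln (s / x)) (fun x : R => x `^ (b - 1))).
    apply: (@continuous_comp _ _ _ (fun s : R => s / x) (@ln R)).
      exact: mulrr_continuous.
    by apply: continuous_ln; rewrite divr_gt0// (lt_trans x0).
  by apply: powR_continuous; rewrite ln_gt0// ltr_pdivlMr// mul1r.
rewrite [RHS]integral_mkcond; apply: eq_integral => s _; rewrite patchE /g/=.
rewrite mem_setE in_itv/= x1/=; case: ifPn => // /andP[xs st].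
by rewrite AE// -EFinM; congr EFin; rewrite /hker; ring.
Qed.

End tonelli.

End semigroup.

Lemma hker1 {R : realType} (t s : R) : hker 1 t s = s^-1.
Proof. by rewrite /hker subrr powRr0 mul1r. Qed.

Section semigroup_real.
Context {R : realType} (b : R) (b01 : 0 < b < 1).
Notation mu := (@lebesgue_measure R).

Let b0 : 0 < b. Proof. by case/andP: b01. Qed.
Let b'0 : 0 < 1 - b. Proof. by rewrite subr_gt0; case/andP: b01. Qed.

Lemma had_had_ge0 (t : R) (f : R -> R) : 1 < t ->
  {within `[1, t], continuous f} -> {in `[1, t], forall s, 0 <= f s} ->
  ((had (1 - b) 1 (had b 1 f) t)%:E = beta_integral b * (had 1 1 f t)%:E)%E.
Proof.
move=> t1 cf f0.
have ch := had_continuous b t f b0 cf.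
rewrite !EFin_had//.
rewrite integral_itv_bndoo; last first.
  by apply/measurable_EFinP; apply: measurable_fun_hkerM.
rewrite [in RHS]integral_itv_bndoo; last first.
  by apply/measurable_EFinP; apply: measurable_fun_hkerM.
rewrite (tonelli_had b b01 t f cf f0); congr (_ * _)%E.
by apply: eq_integral => s _; rewrite hker1 mulrC.
Qed.

(** For f = 1 and t = 2 the left-hand side of the identity is a real number
and the factor of the Beta integral on the right is positive. *)
Lemma beta_integral_fin_num : beta_integral b \is a fin_num.
Proof.
have c1 : {within `[1, 2], continuous (cst 1 : R -> R)}.
  exact: cst_within_continuous.
have l0 : 0 < had 1 1 (cst 1) (2 : R).
  by rewrite had_cst ?ler1n// !divr1 powRr1 ?mul1r ?ln_gt0 ?ln_ge0 ?ltr1n ?ler1n.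
have E : ((had (1 - b) 1 (had b 1 (cst 1)) 2)%:E =
    beta_integral b * (had 1 1 (cst 1) 2)%:E)%E.
  by apply: had_had_ge0; rewrite ?ltr1n// => s _; exact: ler01.
rewrite ge0_fin_numE; last exact: le_trans (beta_integral_ge1 b b01).
rewrite ltey; apply/eqP => binf; move: E.
by rewrite binf gt0_mulye ?lte_fin.
Qed.

Definition beta_const : R := fine (beta_integral b).

Lemma beta_const_ge1 : 1 <= beta_const.
Proof.
by rewrite -lee_fin /beta_const fineK ?beta_integral_fin_num ?beta_integral_ge1.
Qed.

(** The semigroup property: up to constants, the integral of order 1 - b of the
integral of order b is the integral of order 1, that is, of f(s) ds/s. The sign
condition of the Tonelli argument is removed by adding a constant. *)
Lemma had_had (t : R) (f : R -> R) : {within `[1, t], continuous f} ->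
  had (1 - b) 1 (had b 1 f) t = beta_const * had 1 1 f t.
Proof.
move=> cf; have [t1|t1] := leP t 1; first by rewrite !had_degenerate ?mulr0.
have ge0 (g : R -> R) : {within `[1, t], continuous g} ->
    {in `[1, t], forall s, 0 <= g s} ->
    had (1 - b) 1 (had b 1 g) t = beta_const * had 1 1 g t.
  move=> cg g0; apply: EFin_inj; rewrite (had_had_ge0 t g t1 cg g0) EFinM.
  by rewrite -(fineK beta_integral_fin_num).
have [N _ Nf] := compact_continuous_bounded _ _ (@segment_compact R _ _) cf.
pose c : R -> R := cst `|N|.
have cc : {within `[1, t], continuous c} by exact: cst_within_continuous.
have cfN : {within `[1, t], continuous (fun s => f s + c s)}.
  by move=> x; apply: cvgD; [exact: cf|exact: cc].
have := ge0 _ cfN; rewrite (hadD 1 1 t ltr01 ltr01 f c cf cc).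
have -> : had (1 - b) 1 (had b 1 (fun s => f s + c s)) t =
    had (1 - b) 1 (fun s => had b 1 f s + had b 1 c s) t.
  apply: eq_had => s; rewrite in_itv/= => /andP[s1 st].
  apply: (hadD b 1 s b0 ltr01 f c).
    by apply: continuous_subspaceW cf; apply: subset_itv; rewrite bnd_simp.
  by apply: continuous_subspaceW cc; apply: subset_itv; rewrite bnd_simp.
rewrite (hadD (1 - b) 1 t b'0 ltr01 (had b 1 f) (had b 1 c)); last 2 first.
- exact: had_continuous.
- exact: had_continuous.
rewrite (ge0 c cc); last by move=> s _; rewrite /c/= normr_ge0.
rewrite mulrDr => /(_ _)/addIr; apply => s /Nf; rewrite /c/= ler_norml => /andP[+ _].
by rewrite -subr_ge0 opprK => /le_trans; apply; rewrite lerD2l ler_norm.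
Qed.

End semigroup_real.

(** * The Gamma function on (0, 1) is positive *)

Lemma integral_powR_lty {R : realType} (a : R) : 0 < a ->
  (\int[lebesgue_measure]_(s in `]0%R, 1%R[) (s `^ (a - 1))%:E < +oo)%E.
Proof.
move=> a0; pose F (s : R) := a^-1 * Num.max s 0 `^ a.
suff -> : (\int[lebesgue_measure]_(s in `]0%R, 1%R[) (s `^ (a - 1))%:E =
    \int[lebesgue_measure]_(s in `]F 0%R, F 1%R[) (cst 1 s)%:E)%E.
  have F01 : F 0 < F 1.
    rewrite /F maxxx powR0 ?gt_eqF// mulr0 max_l ?ler01//.
    by rewrite powR1 mulr1 invr_gt0.
  by rewrite (integral_itvoo_cst 1)// ltry.
transitivity (\int[lebesgue_measure]_(s in `]0%R, 1%R[)
    (cst 1 (F s) * s `^ (a - 1))%:E)%E.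
  by apply: eq_integral => s _; rewrite mul1r.
symmetry; apply: (@ge0_integration_by_substitution_oo R F (fun s => s `^ (a - 1))
  (cst 1) 0 1 ltr01).
- by move=> s; rewrite in_itv/= => /andP[s0 _]; rewrite powR_gt0.
- move=> s; rewrite in_itv/= => /andP[s0 _].
  apply: (@near_eq_is_derive _ _ _ (fun s => a^-1 * s `^ a)).
    by near=> y; rewrite /F max_l// ltW//; near: y; exact: lt_nbhsr.
  have d : is_derive s 1 (fun s : R => a^-1 * s `^ a) (a^-1 *: (a * s `^ (a - 1))).
    by apply: is_deriveZ; exact: is_derive1_powR.
  apply: (is_derive_eq d).
  by rewrite -[_ *: _]/(_ * _) mulrA mulVf ?mul1r// gt_eqF.
- by move=> s; rewrite in_itv/= => /andP[s0 _]; exact: powR_continuous.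
- apply: continuous_subspaceT => s; apply: cvgM; first exact: cvg_cst.
  exact: max0_powR_continuous.
- by move=> s _; exact: cvg_cst.
- by move=> s _.
Unshelve. all: end_near. Qed.

(** Positivity of the real number requires finiteness of the integral: the
integrand is at most s^(a - 1) on ]0, 1[ and the exponential density after. *)
Lemma Gamma_gt0 {R : realType} (a : R) : 0 < a -> a < 1 -> 0 < Gamma a.
Proof.
move=> a0 a1.
pose g (s : R) := s `^ (a - 1) * expR (- s).
have g0 s : 0 <= g s by rewrite mulr_ge0 ?powR_ge0 ?expR_ge0.
have gc s : 0 < s -> {for s, continuous g}.
  move=> s0; apply: cvgM; first exact: powR_continuous.
  apply: (@continuous_comp _ _ _ (fun s : R => - s) (@expR R)).
    exact: opp_continuous.
  exact: continuous_expR.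
have mg : measurable_fun (`]0, +oo[%classic : set R) g.
  apply: open_continuous_measurable_fun => //.
  by move=> s; rewrite inE/= in_itv/= andbT; exact: gc.
have mp : measurable_fun (`]0, 1[%classic : set R) (fun s : R => s `^ (a - 1)).
  by apply: measurable_funTS; exact: measurable_powR.
pose h (s : R) := ((fun s : R => s `^ (a - 1)) \_ `]0, 1[) s.
have mh : measurable_fun setT h by apply/(measurable_restrictT _ (measurable_itv _)).
have h0 s : 0 <= h s by rewrite /h patchE; case: ifP => // _; exact: powR_ge0.
have fin : (\int[lebesgue_measure]_(s in `]0%R, +oo[) (g s)%:E < +oo)%E.
  apply: (@le_lt_trans _ _ (\int[lebesgue_measure]_s
      ((h s)%:E + (exponential_pdf 1 s)%:E))%E).
    rewrite integral_mkcond; apply: ge0_le_integral => //.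
    - by move=> s _; apply: erestrict_ge0 => {}s _; rewrite lee_fin.
    - by apply/(measurable_restrictT _ (measurable_itv _)); exact/measurable_EFinP.
    - apply: emeasurable_funD; apply/measurable_EFinP => //.
      exact: measurable_exponential_pdf.
    - move=> s _; rewrite patchE; case: ifPn => [|_]; last first.
        by rewrite adde_ge0 ?lee_fin// exponential_pdf_ge0.
      rewrite inE/= in_itv/= andbT => s0.
      rewrite -EFinD lee_fin exponential_pdfE ?(ltW s0)//.
      rewrite mul1r mulN1r /h patchE.
      have e1 : expR (- s) <= 1 by rewrite -expR0 ler_expR oppr_le0 ltW.
      have [s1|s1] := ltP s 1.
        rewrite ifT ?inE/= ?in_itv/= ?s0//.
        by rewrite ler_wpDr ?expR_ge0// /g -[leRHS]mulr1 ler_wpM2l// powR_ge0.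
      rewrite ler_wpDl//; first exact: h0 s.
      have sp : s `^ (a - 1) <= s `^ 0 by rewrite ler_powR// subr_le0 ltW.
      by rewrite /g -[leRHS]mul1r ler_wpM2r ?expR_ge0// (le_trans sp)// powRr0.
  rewrite ge0_integralD//; last 4 first.
  - by move=> s _; rewrite lee_fin.
  - exact/measurable_EFinP.
  - by move=> s _; rewrite lee_fin exponential_pdf_ge0.
  - by apply/measurable_EFinP; exact: measurable_exponential_pdf.
  rewrite integral_exponential_pdf// lte_add_pinfty ?ltry//.
  apply: le_lt_trans (integral_powR_lty a a0).
  rewrite [leRHS]integral_mkcond le_eqVlt; apply/orP; left; apply/eqP.
  by apply: eq_integral => s _; rewrite /h !patchE; case: ifP.
have pos : ((expR (-1))%:E <= \int[lebesgue_measure]_(s in `]0%R, +oo[) (g s)%:E)%E.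
  apply: (@le_trans _ _ (\int[lebesgue_measure]_(s in `]0%R, 1%R[) (g s)%:E)%E); last first.
    apply: ge0_subset_integral => //.
    - exact/measurable_EFinP.
    - by move=> s _; rewrite lee_fin.
    - by apply: subset_itv; rewrite bnd_simp.
  have := integral_itvoo_cst (expR (-1)) (0 : R) 1 ltr01.
  rewrite subr0 mulr1 => E; rewrite -[leLHS]E.
  apply: ge0_le_integral => //.
  - apply/measurable_EFinP; apply: measurable_funS mg => //.
    by apply: subset_itv; rewrite bnd_simp.
  - move=> s; rewrite /= in_itv/= => /andP[s0 s1]; rewrite lee_fin.
    have sp : s `^ 0 <= s `^ (a - 1).
      by rewrite ger_powR ?s0 ?(ltW s1)// subr_le0 ltW.
    rewrite -[leLHS]mul1r ler_pM ?expR_ge0//; first by rewrite powRr0 in sp.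
    by rewrite ler_expR lerN2 ltW.
have fn : (\int[lebesgue_measure]_(s in `]0%R, +oo[) (g s)%:E)%E \is a fin_num.
  rewrite ge0_fin_numE//; apply: le_trans pos; rewrite lee_fin; exact: expR_ge0.
rewrite -lte_fin /Gamma /Rintegral -[X in (_ < X)%E]/(fine _)%:E.
by apply: lt_le_trans (le_trans pos _); [rewrite lte_fin expR_gt0|rewrite fineK].
Qed.

(** * Time increments at a maximum *)

(** If k attains its maximum over [a, t0] at t0, then k(t0) - k is nonnegative,
and since the kernel of order b <= 1 decreases in t, the part of the integral of
k(t0) - k over [a, t'] can only decrease from t' to t0. Hence the integral of k
increases at least as that of the constant k(t0), up to the contribution of
[t', t0], on which k(t0) - k is at most w. *)
Lemma had_max_increment {R : realType} (b a t' t0 w : R) (k : R -> R) :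
  0 < b <= 1 -> 0 < a -> a <= t' -> t' < t0 ->
  {within `[a, t0], continuous k} ->
  {in `[a, t0], forall s, k s <= k t0} ->
  {in `[t', t0], forall s, k t0 - k s <= w} ->
  k t0 * ((ln (t0 / a) `^ b - ln (t' / a) `^ b) / b) - w * (ln (t0 / t') `^ b / b)
  <= had b a k t0 - had b a k t'.
Proof.
move=> /andP[b0 b1] a0 at' t't0 ck kM kw.
have t'0 : 0 < t' by exact: lt_le_trans at'.
have at0 : a <= t0 by rewrite (le_trans at')// ltW.
pose m (s : R) := cst (k t0) s - k s.
have cc x y : {within `[x, y], continuous (cst (k t0) : R -> R)}.
  exact: cst_within_continuous.
have ck' : {within `[a, t'], continuous k}.
  by apply: continuous_subspaceW ck; apply: subset_itv; rewrite bnd_simp// ltW.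
have cm : {within `[a, t0], continuous m}.
  by move=> x; apply: cvgB; [exact: cc|exact: ck].
have cm' : {within `[a, t'], continuous m}.
  by move=> x; apply: cvgB; [exact: cc|exact: ck'].
have cm'' : {within `[t', t0], continuous m}.
  by apply: continuous_subspaceW cm; apply: subset_itv; rewrite bnd_simp.
have E0 : had b a m t0 = k t0 * (ln (t0 / a) `^ b / b) - had b a k t0.
  by rewrite -(had_cst b a t0 b0 a0 (k t0) at0); exact: hadB.
have E1 : had b a m t' = k t0 * (ln (t' / a) `^ b / b) - had b a k t'.
  by rewrite -(had_cst b a t' b0 a0 (k t0) at'); exact: hadB.
have S := had_split b a t' t0 m b0 a0 at' (ltW t't0) cm.
have int0 := had_integrable b a t0 b0 a0 m cm.
have int1 := had_integrable b a t' b0 a0 m cm'.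
have sub : `[a, t'[ `<=` `[a, t0].
  by apply: subset_itv; rewrite bnd_simp// ltW.
have sub' : `[a, t'[ `<=` `[a, t'] by apply: subset_itv; rewrite bnd_simp.
have int0' : lebesgue_measure.-integrable `[a, t'[ (EFin \o (fun s => hker b t0 s * m s)).
  exact: integrableS int0.
have int1' : lebesgue_measure.-integrable `[a, t'[ (EFin \o (fun s => hker b t' s * m s)).
  exact: integrableS int1.
have U1 : \int[lebesgue_measure]_(s in `[a, t']) (hker b t0 s * m s) <= had b a m t'.
  have e0 := @Rintegral_itv_bndo_bndc R (BLeft a) t' (fun s => hker b t0 s * m s) int0'.
  have e1 := @Rintegral_itv_bndo_bndc R (BLeft a) t' (fun s => hker b t' s * m s) int1'.
  rewrite hadE -e0 -e1; apply: le_Rintegral => //.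
  move=> s.
  rewrite /= => sI; have := sI; rewrite in_itv/= => /andP[as_ st'].
  have s0 : 0 < s by exact: lt_le_trans as_.
  apply: ler_wpM2r; first by rewrite subr_ge0 kM//; exact: sub.
  rewrite ler_pM2r ?invr_gt0// /powR.
  have l1 : 0 < ln (t' / s) by rewrite ln_gt0// ltr_pdivlMr// mul1r.
  have l2 : 0 < ln (t0 / s) by rewrite ln_gt0// ltr_pdivlMr// mul1r (lt_trans st').
  have p1 : 0 < t' / s by rewrite divr_gt0.
  have p2 : 0 < t0 / s by rewrite divr_gt0// (lt_trans t'0).
  rewrite !gt_eqF// ler_expR; apply: ler_wnM2l; first by rewrite subr_le0.
  rewrite ler_ln ?posrE// ler_ln ?posrE//.
  by rewrite ler_pM2r ?invr_gt0// ltW.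
have U2 : had b t' m t0 <= w * (ln (t0 / t') `^ b / b).
  rewrite -(had_cst b t' t0 b0 t'0 w (ltW t't0)); apply: had_le => //.
  exact: cst_within_continuous.
rewrite mulrBl mulrBr.
move: E0 E1 U1 U2; rewrite S.
move: (had b a k t0) (had b a k t') (had b a m t') (had b t' m t0) (\int[_]_(_ in _) _).
move: (k t0 * _) (k t0 * _) (w * _) => X Y Z A0 A1 A2 A3 A4.
clear; lra.
Qed.

Lemma had1_sub {R : realType} (s t : R) (f : R -> R) : 1 <= s -> s <= t ->
  {within `[1, t], continuous f} ->
  had 1 1 f t - had 1 1 f s = had 1 s f t.
Proof.
move=> s1 st cf; rewrite (had_split 1 1 s t f ltr01 ltr01 s1 st cf).
rewrite addrAC [X in X + _](_ : _ = 0) ?add0r//; apply/eqP; rewrite subr_eq0.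
by rewrite hadE; apply/eqP; apply: eq_Rintegral => x _; rewrite !hker1.
Qed.

Lemma had1_ge {R : realType} (s t c : R) (f : R -> R) : 0 < s -> s <= t ->
  {within `[s, t], continuous f} -> {in `[s, t], forall x, c <= f x} ->
  c * ln (t / s) <= had 1 s f t.
Proof.
move=> s0 st cf fc.
have l0 : 0 <= ln (t / s) by rewrite ln_ge0// ler_pdivlMr// mul1r.
rewrite -[leLHS]divr1 -mulrA -{1}(powRr1 l0) -(had_cst 1 s t ltr01 s0 c st).
by apply: had_le => //; exact: cst_within_continuous.
Qed.

Lemma had1_le {R : realType} (s t c : R) (f : R -> R) : 0 < s -> s <= t ->
  {within `[s, t], continuous f} -> {in `[s, t], forall x, f x <= c} ->
  had 1 s f t <= c * ln (t / s).
Proof.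
move=> s0 st cf fc.
have l0 : 0 <= ln (t / s) by rewrite ln_ge0// ler_pdivlMr// mul1r.
rewrite -[leRHS]divr1 -mulrA -{1}(powRr1 l0) -(had_cst 1 s t ltr01 s0 c st).
by apply: had_le => //; exact: cst_within_continuous.
Qed.

(** Before the base point the integral is 0, so that it may be composed with
Num.max 1. The times below 1 appear when an integral is compared with its
dilation by q, which starts at 1/q. *)
Lemma had_continuous_extended {R : realType} (b l T : R) (f : R -> R) :
  0 < b -> {within `[1, T], continuous f} ->
  {within `[l, T], continuous (had b 1 f)}.
Proof.
have max_lip (x y : R) : `|Num.max 1 x - Num.max 1 y| <= `|x - y|.
  have n1 := ler_norm (x - y); have n2 := ler_norm (y - x).
  rewrite distrC in n2; rewrite ler_norml; move: n1 n2; move: `|x - y| => z n1 n2.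
  by case: (leP x 1) => h1; case: (leP y 1) => h2; apply/andP; split; lra.
move=> b0 cf; have [T1|T1] := ltP T 1.
  apply: (@subspace_eq_continuous _ _ _ (cst 0 : R -> R)); last exact: cst_within_continuous.
  move=> t; rewrite inE/= in_itv/= => /andP[_ tT].
  by rewrite /from_subspace/= had_degenerate// (le_trans tT)// ltW.
have /within_continuousP ch := had_continuous b T f b0 cf.
apply/within_continuousP => t; rewrite /= in_itv/= => /andP[lt tT] e e0.
have E y : had b 1 f y = had b 1 f (Num.max 1 y).
  have [y1|y1] := leP y 1; last by [].
  by rewrite (had_degenerate b 1 y f y1) (had_degenerate b 1 1 f (lexx 1)).
have mI y : y <= T -> `[1, T]%classic (Num.max 1 y).
  by move=> yT; rewrite /= in_itv/= le_max lexx ge_max T1.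
have [d d0 h] := ch _ (mI _ tT) e e0.
exists d => // y; rewrite /= in_itv/= => /andP[_ yT] ty.
rewrite E [had b 1 f y]E; apply: h; first exact: mI.
by apply: le_lt_trans ty; exact: max_lip.
Qed.

Section dilation.
Context {R : realType} (b : R) (b01 : 0 < b < 1).
Let b0 : 0 < b. Proof. by case/andP: b01. Qed.
Let b'0 : 0 < 1 - b. Proof. by rewrite subr_gt0; case/andP: b01. Qed.

(** The dilation identity and the semigroup property: the integral of order
1 - b of an increment of the integral of order b is the integral of f(s) ds/s
over [t, q * t]. *)
Lemma had_dilation_increment (q t : R) (f : R -> R) : 1 <= q ->
  q^-1 <= t -> {within `[1, q * t], continuous f} ->
  had (1 - b) q^-1 (fun s => had b 1 f (q * s) - had b 1 f s) t =
  beta_const b * (had 1 1 f (q * t) - had 1 1 f t).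
Proof.
move=> q1 qt cf; have q0 : 0 < q by exact: lt_le_trans q1.
have qV0 : 0 < q^-1 by rewrite invr_gt0.
have qVq : q * q^-1 = 1 by rewrite divff// gt_eqF.
have tqt : t <= q * t by rewrite ler_peMl// (le_trans _ qt)// ltW.
have cft : {within `[1, t], continuous f}.
  by apply: continuous_subspaceW cf; apply: subset_itv; rewrite bnd_simp.
have c1 : {within `[q * q^-1, q * t], continuous (had b 1 f)}.
  by rewrite qVq; exact: had_continuous.
have c2 := within_compM_continuous _ _ _ _ q0 c1.
have c3 : {within `[q^-1, t], continuous (had b 1 f)}.
  exact: had_continuous_extended.
have E := had_scale (1 - b) q^-1 q t (had b 1 f) b'0 qV0 q0 c1.
rewrite qVq (had_had b b01 (q * t) f cf) in E.
have z s : s \in `[q^-1, 1] -> had b 1 f s = 0.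
  by rewrite in_itv/= => /andP[_ s1]; rewrite had_degenerate.
have qV1 : q^-1 <= 1 by rewrite invf_le1.
have E' : had (1 - b) q^-1 (had b 1 f) t = beta_const b * had 1 1 f t.
  rewrite -(had_had b b01 t f cft).
  have [t1|t1] := leP t 1.
    rewrite [RHS](had_degenerate (1 - b) 1 t)//.
    rewrite (eq_had (1 - b) q^-1 t (had b 1 f) (cst 0)); last first.
      by move=> s sI; rewrite z//; move: s sI; apply: subset_itv; rewrite bnd_simp.
    by rewrite (had_cst (1 - b) q^-1 t b'0 qV0 0 qt) mul0r.
  rewrite (had_split (1 - b) q^-1 1 t (had b 1 f) b'0 qV0 qV1 (ltW t1) c3).
  rewrite [X in X + _](_ : _ = 0) ?add0r//.
  transitivity (\int[lebesgue_measure]_(s in `[q^-1, 1]) (0 : R)).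
    by apply: eq_Rintegral => s; rewrite inE => /z ->; rewrite mulr0.
  by rewrite Rintegral_cst// mul0r.
rewrite (hadB (1 - b) q^-1 t b'0 qV0 (fun s => had b 1 f (q * s)) (had b 1 f) c2 c3).
by rewrite E' -E mulrBr.
Qed.

End dilation.

Lemma powR_increment_ge {R : realType} (r x y L : R) : 0 < r -> r < 1 ->
  0 < x -> x < y -> y <= L ->
  (y - x) * L `^ (r - 1) <= (y `^ r - x `^ r) / r.
Proof.
move=> r0 r1 x0 xy yL; have y0 := lt_trans x0 xy; have L0 := lt_le_trans y0 yL.
have pos z : x <= z -> 0 < z by exact: lt_le_trans.
have [|z|c cxy E] := @MVT R (fun z => z `^ r) (fun z => r * z `^ (r - 1)) x y xy.
- move=> z; rewrite in_itv/= => /andP[xz _]; apply: is_derive1_powR.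
  exact: lt_trans xz.
- apply: continuous_in_subspaceT => s; rewrite inE/= in_itv/= => /andP[xs _].
  by apply: powR_continuous; exact: pos.
move: cxy; rewrite in_itv/= => /andP[xc cy]; have c0 := lt_trans x0 xc.
rewrite /= in E; rewrite E.
have -> : r * c `^ (r - 1) * (y - x) / r = (y - x) * c `^ (r - 1).
  by field; rewrite gt_eqF.
rewrite ler_pM2l ?subr_gt0// /powR !gt_eqF// ler_expR.
by apply: ler_wnM2l; rewrite ?subr_le0 ?(ltW r1)// ler_ln// (ltW (lt_le_trans cy yL)).
Qed.

Lemma ln_le_sub1 {R : realType} (x : R) : 0 < x -> ln x <= x - 1.
Proof.
move=> x0; have := @le_ln1Dx R (x - 1).
by rewrite [1 + _]addrC subrK; apply; rewrite ltrBrDl addrN.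
Qed.

Section dilation_max.
Context {R : realType} (b : R) (b01 : 0 < b < 1).
Let b0 : 0 < b. Proof. by case/andP: b01. Qed.
Let b'0 : 0 < 1 - b. Proof. by rewrite subr_gt0; case/andP: b01. Qed.
Let b'1 : 1 - b < 1. Proof. by rewrite gtrBl. Qed.

(** The time part of the maximum principle. The integral of order 1 - b of k
is a multiple of the integral of f(s) ds/s over [t, q * t], whose derivative
with respect to ln t at t0 is f(q * t0) - f(t0); for t0 < 1 only the part of
[t, q * t] after 1 counts, and then f 1 <= 0 allows f 1 to replace the missing
term.
Because k is maximal at t0, the same increment is at least k(t0) times that of
ln(q * t)^(1 - b) / (1 - b). The left Lipschitz bound on k makes the error
term of the comparison of order l^(2 - b), with l = ln(t0 / t'), hence
negligible with respect to l. *)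
Lemma had_dilation_max (T q t0 t1 K : R) (f : R -> R)
    (k := fun s => had b 1 f (q * s) - had b 1 f s) :
  1 < q -> q^-1 < t0 -> q * t0 <= T -> {within `[1, T], continuous f} ->
  f 1 <= 0 -> 0 < k t0 ->
  {in `[q^-1, t0], forall s, k s <= k t0} ->
  t1 < t0 -> {in `[t1, t0], forall s, k t0 - k s <= K * (t0 - s)} ->
  k t0 * ln T `^ (- b) <= beta_const b * (f (q * t0) - f (Num.max 1 t0)).
Proof.
move=> q1 qt0 qt0T cf f1 k0 kmax t10 kK.
have q0 : 0 < q by exact: lt_trans q1.
have qV0 : 0 < q^-1 by rewrite invr_gt0.
have t00 : 0 < t0 by exact: lt_trans qt0.
have qt01 : 1 < q * t0 by rewrite -(divff (lt0r_neq0 q0)) ltr_pM2l.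
have T1 : 1 < T by exact: lt_le_trans qt0T.
have t0T : t0 < T by rewrite (lt_le_trans _ qt0T)// ltr_pMl.
set C := beta_const b; have C1 : 1 <= C by exact: beta_const_ge1.
apply/ler_addgt0Pr => e e0.
have C21 : 0 < 2 * C + 1 by lra.
pose e1 := e / (2 * C + 1).
have e10 : 0 < e1 by rewrite divr_gt0.
have /within_continuousP cf' := cf.
have I1 : `[1, T]%classic (q * t0) by rewrite /= in_itv/= (ltW qt01).
have I2 : `[1, T]%classic (Num.max 1 t0).
  by rewrite /= in_itv/= le_max lexx ge_max (ltW T1) (ltW t0T).
have [d1 d10 h1] := cf' _ I1 e1 e10.
have [d2 d20 h2] := cf' _ I2 e1 e10.
pose K' := `|K| * T + 1.
have K'0 : 0 < K' by rewrite ltr_wpDl// mulr_ge0// ltW// (lt_trans _ T1).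
(* e3 bounds l in such a way that |K| * T * l^(1 - b) / (1 - b) <= e1. *)
pose e3 := (e1 * (1 - b) / K') `^ (1 - b)^-1.
have e30 : 0 < e3 by rewrite powR_gt0// divr_gt0// mulr_gt0.
pose d := Num.min (Num.min d1 e3 / q) d2.
have d_0 : 0 < d by rewrite lt_min d20 andbT divr_gt0// lt_min d10.
pose lo := Num.max (Num.max t1 q^-1) (Num.max (t0 - d) (if 1 < t0 then 1 else t1)).
have lot0 : lo < t0.
  rewrite !gt_max t10 qt0 ltrBlDr ltrDl d_0/=.
  by case: ifPn.
pose t' := (lo + t0) / 2.
have [lt' t't0] : lo < t' /\ t' < t0.
  by rewrite /t'; split; rewrite midf_lt.
move: lt'; rewrite !gt_max => /andP[/andP[t1t' qt'] /andP[t0d t01]].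
have t'0 : 0 < t' by exact: lt_trans qt'.
have : t0 - t' < d by rewrite ltrBlDr -ltrBlDl.
rewrite /d lt_min ltr_pdivlMr// lt_min => /andP[/andP[td1 td3] td2].
have cqt0 : {within `[1, q * t0], continuous f}.
  by apply: continuous_subspaceW cf; apply: subset_itv; rewrite bnd_simp.
have cqt' : {within `[1, q * t'], continuous f}.
  apply: continuous_subspaceW cqt0; apply: subset_itv; rewrite bnd_simp//.
  by rewrite ler_pM2l// ltW.
have ct0 : {within `[1, t0], continuous f}.
  apply: continuous_subspaceW cf; apply: subset_itv; rewrite bnd_simp//.
  exact: ltW.
have lnB (x y : R) : 0 < x -> 0 < y -> ln (x / y) = ln x - ln y.
  by move=> x0 y0; rewrite ln_div.
pose l := ln (t0 / t').
have l0 : 0 < l by rewrite ln_gt0// ltr_pdivlMr// mul1r.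
have ll : l <= (t0 - t') * q.
  apply: (le_trans (ln_le_sub1 _ (divr_gt0 t00 t'0))).
  rewrite -(divff (lt0r_neq0 t'0)) -mulrBl ler_pM2l ?subr_gt0//.
  by rewrite -[leRHS]invrK lef_pV2 ?posrE// ltW.
have tl : t0 - t' <= T * l.
  have H' : ln (t' / t0) <= t' / t0 - 1 by rewrite ln_le_sub1// divr_gt0.
  have : l = - ln (t' / t0) by rewrite /l (lnB t0 t')// (lnB t' t0)// opprB.
  move=> lE; have : t0 * (1 - t' / t0) <= t0 * l.
    by rewrite ler_pM2l// lE lerNr opprB.
  rewrite mulrBr mulr1 mulrCA divff ?gt_eqF// mulr1 => /le_trans; apply.
  by rewrite ler_pM2r// ltW.
(* t' < t0 is so close to t0 that f varies by at most e1 on [q * t', q * t0]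
   and, when 1 < t0, on [t', t0], and that the error term is at most e1 * l. *)
have Q0 := had_dilation_increment b b01 q t0 f (ltW q1) (ltW qt0) cqt0.
have Q' := had_dilation_increment b b01 q t' f (ltW q1) (ltW qt') cqt'.
rewrite -/k -/C in Q0 Q'.
have ck : {within `[q^-1, t0], continuous k}.
  move=> x; apply: cvgB; last first.
    exact: (had_continuous_extended b q^-1 t0 f b0 ct0 x).
  apply: (within_compM_continuous q q^-1 t0 (had b 1 f) q0) x.
  by rewrite divff ?gt_eqF//; exact: had_continuous.
have kw : {in `[t', t0], forall s, k t0 - k s <= `|K| * (t0 - t')}.
  move=> s; rewrite in_itv/= => /andP[ts st].
  rewrite (le_trans (kK s _))//; first by rewrite in_itv/= st (le_trans (ltW t1t')).
  apply: (@le_trans _ _ (`|K| * (t0 - s))).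
    by rewrite ler_wpM2r ?subr_ge0// ler_norm.
  by rewrite ler_wpM2l// lerD2l lerN2.
have b'01 : 0 < 1 - b <= 1 by rewrite b'0 ltW.
have inc := had_max_increment (1 - b) q^-1 t' t0 (`|K| * (t0 - t')) k
  b'01 qV0 (ltW qt') t't0 ck kmax kw.
rewrite Q0 Q' -/l in inc.
have U1 : had 1 1 f (q * t0) - had 1 1 f (q * t') <= (f (q * t0) + e1) * l.
  have qt'1 : 1 <= q * t' by rewrite -(divff (lt0r_neq0 q0)) ler_pM2l// ltW.
  have qtt : q * t' <= q * t0 by rewrite ler_pM2l// ltW.
  rewrite (had1_sub _ _ f qt'1 qtt cqt0).
  have -> : l = ln (q * t0 / (q * t')) by rewrite -mulf_div divff ?gt_eqF// mul1r.
  apply: had1_le => //; first by rewrite mulr_gt0.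
    by apply: continuous_subspaceW cqt0; apply: subset_itv; rewrite bnd_simp.
  move=> s; rewrite in_itv/= => /andP[s1 s2].
  have hb : ball (q * t0) d1 s.
    rewrite /ball/= ger0_norm ?subr_ge0// (le_lt_trans _ td1)//.
    by rewrite [leRHS]mulrC mulrBr lerD2l lerN2.
  have sI : `[1, T]%classic s.
    by rewrite /= in_itv/= (le_trans qt'1)// (le_trans s2).
  by have /ltW := h1 s sI hb; rewrite ler_distlC => /andP[_].
have U2 : (f (Num.max 1 t0) - e1) * l <= had 1 1 f t0 - had 1 1 f t'.
  have [t0le|t0gt] := leP t0 1.
    rewrite (had_degenerate 1 1 t0 f t0le) (had_degenerate 1 1 t' f); last first.
      by rewrite (le_trans (ltW t't0)).
    by rewrite subrr pmulr_lle0// subr_le0 (le_trans f1)// ltW.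
  rewrite t0gt in t01.
  rewrite (had1_sub _ _ f (ltW t01) (ltW t't0) ct0).
  apply: had1_ge => //; first exact: ltW.
    by apply: continuous_subspaceW ct0; apply: subset_itv; rewrite bnd_simp// ltW.
  move=> s; rewrite in_itv/= => /andP[s1 s2].
  have hb : ball t0 d2 s.
    rewrite /ball/= ger0_norm ?subr_ge0// (le_lt_trans _ td2)//.
    by rewrite lerD2l lerN2.
  have sI : `[1, T]%classic s.
    by rewrite /= in_itv/= (le_trans (ltW t01))// (le_trans s2 (ltW t0T)).
  have := h2 s sI; rewrite max_r ?(ltW t0gt)// => /(_ hb)/ltW.
  by rewrite ler_distlC => /andP[].
have U3 : l * ln T `^ (1 - b - 1) <=
    (ln (t0 / q^-1) `^ (1 - b) - ln (t' / q^-1) `^ (1 - b)) / (1 - b).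
  have -> : l = ln (t0 / q^-1) - ln (t' / q^-1).
    by rewrite /l (lnB t0 t')// (lnB t0 q^-1)// (lnB t' q^-1)//; ring.
  have p1 : 0 < t' / q^-1 by rewrite divr_gt0.
  have p2 : 0 < t0 / q^-1 by rewrite divr_gt0.
  apply: powR_increment_ge => //.
  - by rewrite ln_gt0// ltr_pdivlMr// mul1r.
  - by rewrite ltr_ln ?posrE// ltr_pM2r// invrK.
  - rewrite ler_ln ?posrE//; last exact: lt_trans T1.
    by rewrite invrK mulrC.
have U4 : `|K| * (t0 - t') * (l `^ (1 - b) / (1 - b)) <= e1 * l.
  have lp : l `^ (1 - b) <= e1 * (1 - b) / K'.
    have -> : e1 * (1 - b) / K' = e3 `^ (1 - b).
      have z0 : 0 <= e1 * (1 - b) / K' by apply: divr_ge0; [apply: mulr_ge0|]; exact: ltW.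
      by rewrite /e3 -powRrM mulVf ?powRr1// gt_eqF.
    apply: (ge0_ler_powR (ltW b'0)); rewrite ?nnegrE; [exact: ltW|exact: ltW|].
    exact: (le_trans ll (ltW td3)).
  apply: (@le_trans _ _ (`|K| * (T * l) * (e1 * (1 - b) / K' / (1 - b)))).
    apply: ler_pM.
    - by rewrite mulr_ge0// subr_ge0 ltW.
    - by apply: divr_ge0; [exact: powR_ge0|exact: ltW].
    - by rewrite ler_wpM2l.
    - by rewrite ler_pM2r ?invr_gt0.
  have -> : `|K| * (T * l) * (e1 * (1 - b) / K' / (1 - b)) = e1 * l * ((`|K| * T) / K').
    by field; rewrite !gt_eqF.
  rewrite ler_piMr//; first by apply: mulr_ge0; exact: ltW.
  by rewrite ler_pdivrMr// mul1r /K' lerDl.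
have bE : 1 - b - 1 = - b by ring.
rewrite bE in U3; rewrite -(ler_pM2r l0).
have U5 : k t0 * (l * ln T `^ (- b)) <= k t0 *
    ((ln (t0 / q^-1) `^ (1 - b) - ln (t' / q^-1) `^ (1 - b)) / (1 - b)).
  by rewrite ler_wpM2l// ltW.
have e1E : e = e1 * (2 * C + 1) by rewrite /e1 divfK// gt_eqF.
have U6 : C * (had 1 1 f (q * t0) - had 1 1 f (q * t')) <= C * ((f (q * t0) + e1) * l).
  by rewrite ler_wpM2l// (le_trans ler01).
have U7 : C * ((f (Num.max 1 t0) - e1) * l) <= C * (had 1 1 f t0 - had 1 1 f t').
  by rewrite ler_wpM2l// (le_trans ler01).
rewrite e1E.
move: inc U4 U5 U6 U7.
move: (k t0 * (_ / _)) (`|K| * _ * _) (ln T `^ _).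
move: (had 1 1 f t0) (had 1 1 f t') (had 1 1 f (q * t0)) (had 1 1 f (q * t')).
move: (f (q * t0)) (f (Num.max 1 t0)) (k t0) => x1 x2 x3 x4 x5 x6 x7 x8 x9 x10.
clear; nra.
Qed.

End dilation_max.

(** Left Lipschitz at every t, with a constant depending on t: near t = 1 the
function ln(t)^b is not Lipschitz from the right, and from the left it is 0. *)
Lemma had_cst_left_lipschitz {R : realType} (b c t : R) : 0 < b -> b < 1 ->
  exists K d, 0 < d /\ forall s, s <= t -> t - s < d ->
    `|had b 1 (cst c) t - had b 1 (cst c) s| <= K * (t - s).
Proof.
move=> b0 b1; have [t1|t1] := leP t 1.
  exists 0, 1; split => // s st _.
  by rewrite !had_degenerate ?(le_trans st)// subrr normr0 mul0r.
pose L := ln ((1 + t) / 2) : R.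
have t2 : 1 < (1 + t) / 2 by rewrite ltr_pdivlMr//; move: t t1 {L} => t t1; lra.
have L0 : 0 < L by exact: ln_gt0.
exists (`|c| / b * L `^ (b - 1)), ((t - 1) / 2).
split; first by rewrite divr_gt0// subr_gt0.
move=> s st ts; have s1 : (1 + t) / 2 < s by move: t s t1 st ts {L t2 L0} => t s; lra.
have s1' := lt_trans t2 s1.
have s0 : 0 < s by exact: lt_trans s1'.
have t0 : 0 < t by exact: lt_trans t1.
have Ls : L <= ln s by rewrite ler_ln ?ltW// posrE (lt_trans _ t2).
have st' : ln s <= ln t by rewrite ler_ln.
have ls0 : 0 < ln s by exact: ln_gt0.
have lt0 : 0 < ln t by exact: ln_gt0.
rewrite (had_cst b 1 t b0 ltr01 c (ltW t1)) (had_cst b 1 s b0 ltr01 c (ltW s1')).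
rewrite !divr1 -mulrBr -mulrBl normrM -mulrA -mulrA ler_wpM2l//.
have anti (x y : R) : 0 < x -> x <= y -> y `^ (b - 1) <= x `^ (b - 1).
  move=> x0 xy; have y0 := lt_le_trans x0 xy.
  rewrite /powR !gt_eqF// ler_expR.
  by apply: ler_wnM2l; rewrite ?subr_le0 ?(ltW b1)// ler_ln.
have mono : ln s `^ b <= ln t `^ b.
  by apply: (ge0_ler_powR (ltW b0)); rewrite ?nnegrE// ltW.
rewrite normrM ger0_norm ?subr_ge0// gtr0_norm ?invr_gt0// mulrC -mulrA ler_pM2l ?invr_gt0//.
apply: (@le_trans _ _ ((ln t - ln s) * ln s `^ (b - 1))).
  rewrite mulrBl (mulr_powRB1 (ltW ls0) b0) lerD2r -(mulr_powRB1 (ltW lt0) b0).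
  by rewrite ler_pM2l//; exact: anti.
rewrite mulrC; apply: ler_pM => //; rewrite ?powR_ge0 ?subr_ge0//; first exact: anti.
rewrite -ln_div ?posrE//.
apply: (le_trans (ln_le_sub1 (t / s) (divr_gt0 t0 s0))).
have -> : t / s - 1 = (t - s) / s by rewrite mulrBl divff ?gt_eqF.
by rewrite ler_pdivrMr// ler_peMr ?subr_ge0// ltW.
Qed.

(** * Second differences and derivatives on a segment *)

Lemma ge0_is_derive_le {R : realType} (f df : R -> R) (a b : R) : a <= b ->
  (forall x, x \in `]a, b[ -> is_derive x 1 f (df x)) ->
  {within `[a, b], continuous f} ->
  {in `]a, b[, forall x, 0 <= df x} -> f a <= f b.
Proof.
rewrite le_eqVlt => /predU1P[->//|ab] dfE cf df0.
have [c cab E] := MVT ab dfE cf.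
by rewrite -subr_ge0 E mulr_ge0 ?df0// subr_ge0 ltW.
Qed.

(** Two applications of monotonicity: g1 s - A * s is nondecreasing, so that
the derivative of g s + g (- s) - A * s ^+ 2 is nonnegative for s >= 0. *)
Lemma second_difference_ge {R : realType} (g g1 g2 : R -> R) (A h : R) :
  0 < h ->
  (forall s, s \in `[- h, h] -> is_derive s 1 g (g1 s)) ->
  (forall s, s \in `[- h, h] -> is_derive s 1 g1 (g2 s)) ->
  {in `[- h, h], forall s, A <= g2 s} ->
  A * h ^+ 2 <= g h + g (- h) - g 0 *+ 2.
Proof.
move=> h0 dg dg1 Ag2.
have sub s t : s \in `[0, h] -> t \in `[- s, s] -> t \in `[- h, h].
  by rewrite !in_itv/= => /andP[s0 sh] /andP[st ts]; apply/andP; split; lra.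
have subo (x y s : R) : s \in `]x, y[ -> s \in `[x, y].
  by apply: subset_itv; rewrite bnd_simp.
have opp s : s \in `[- h, h] -> - s \in `[- h, h].
  by rewrite !in_itv/= => /andP[s1 s2]; apply/andP; split; lra.
have s_in s : s \in `[0, h] -> s \in `[- h, h].
  by rewrite !in_itv/= => /andP[s1 s2]; apply/andP; split; lra.
have d2 s : s \in `[0, h] -> g1 (- s) + A * s <= g1 s - A * s.
  move=> sh.
  have ss : - s <= s by move: sh; rewrite in_itv/=; lra.
  pose k (t : R) := g1 t - A * t.
  have dk t : t \in `[- s, s] -> is_derive t 1 k (g2 t - A).
    move=> /(sub _ _ sh) /dg1 dt.
    have dA : is_derive t 1 (fun s : R => A * s) (A *: 1).
      exact: (is_deriveZ A (is_derive_id t 1)).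
    have d : is_derive t 1 k (g2 t - A *: 1) by exact: is_deriveB.
    by apply: (is_derive_eq d); congr (_ - _); exact: mulr1.
  have H : k (- s) <= k s.
    apply: (@ge0_is_derive_le R k (fun t => g2 t - A) (- s) s ss
      (fun t tI => dk t (subo _ _ _ tI))).
    - by apply: derivable_within_continuous => t /dk dt; exact: ex_derive.
    - by move=> t /subo /(sub _ _ sh) /Ag2; rewrite subr_ge0.
  by move: H; rewrite /k mulrN opprK.
pose p (s : R) := g s + g (- s) - A * s ^+ 2.
pose p1 (s : R) := g1 s - g1 (- s) - 2 * (A * s).
have dp s : s \in `[0, h] ->
    is_derive s 1 p (p1 s).
  move=> sh; have ds := dg s (s_in _ sh).
  have dn : is_derive s 1 (fun s => g (- s)) (g1 (- s) * (- 1)).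
    have dN : is_derive s 1 (fun s : R => - s) (- 1).
      exact: (is_deriveN (is_derive_id s (1 : R))).
    exact: (@is_derive1_comp R g (fun s => - s) s _ _ (dg _ (opp _ (s_in _ sh))) dN).
  have dX : is_derive s 1 (fun s : R => s * s) (s *: 1 + s *: 1).
    exact: (is_deriveM (is_derive_id s (1 : R)) (is_derive_id s (1 : R))).
  have dA : is_derive s 1 (fun s : R => A * s ^+ 2) (A *: (s *: 1 + s *: 1)).
    exact: (is_deriveZ A dX).
  have d : is_derive s 1 p (g1 s + g1 (- s) * (- 1) - A *: (s *: 1 + s *: 1)).
    by apply: is_deriveB.
  apply: (is_derive_eq d); rewrite /p1 [in LHS]/GRing.scale/=; ring.
have H : p 0 <= p h.
  have dp' s : s \in `]0, h[ -> is_derive s 1 p (p1 s) by move=> /subo /dp.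
  apply: (@ge0_is_derive_le R p p1 0 h (ltW h0) dp').
  - by apply: derivable_within_continuous => t /dp dt; exact: ex_derive.
  - by move=> s /subo /d2; rewrite /p1; lra.
move: H; rewrite /p oppr0 expr0n/= mulr0 subr0 -mulr2n.
move: (g 0) (g h) (g (- h)) (A * _) => a b c d; clear; lra.
Qed.

Lemma is_derive_line {R : realType} {n : nat} (f : 'rV[R]_n -> R)
    (x e : 'rV[R]_n) (s : R) :
  derivable f (x + s *: e) e ->
  is_derive s 1 (fun s => f (x + s *: e)) ('D_e f (x + s *: e)).
Proof.
have E : (fun h : R => h^-1 *: (((fun s => f (x + s *: e)) \o shift s) (h *: 1)
     - f (x + s *: e))) =
   (fun h : R => h^-1 *: ((f \o shift (x + s *: e)) (h *: e) - f (x + s *: e))).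
  apply/funext => h /=; congr (_ *: (f _ - _)).
  by rewrite -[h *: 1]/(h * 1) mulr1 scalerDl addrCA.
move=> df; apply: DeriveDef; first by rewrite /derivable E.
by rewrite /derive E.
Qed.

(** At an interior point the restriction to the interval is void, so that the
derivatives within [a, b] below are ordinary ones. *)
Lemma dnbhs_within_itv {R : realType} (a b t : R) : a < t < b ->
  within `[a, b] (dnbhs t) = dnbhs t.
Proof.
move=> tab; have N : nbhs t `[a, b]%classic.
  have : t \in `]a, b[ by rewrite in_itv/=.
  move=> /near_in_itvoo; apply: filterS => x; apply: subset_itv;
    by rewrite bnd_simp.
have tI : (dnbhs t) `[a, b]%classic.
  by rewrite /dnbhs /within; apply: filterS N => x xI _.
apply/seteqP; split => P; last exact: cvg_within.
by move=> tP; apply: filterS2 tI tP => x xI; exact.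
Qed.

Lemma cvg_shift_dnbhs {R : realType} (t : R) : (fun h : R => h + t) @ 0^' --> t^'.
Proof.
move=> P /nbhs_ballP[e e0 eP]; apply/nbhs_ballP; exists e => // h.
rewrite /ball/= sub0r normrN => he h0; apply: eP.
  by rewrite /ball/= opprD addrCA subrr addr0 normrN.
by rewrite /= -subr_eq0 addrK.
Qed.

Lemma derivable_within_is_derive {R : realType} (a b t : R) (f : R -> R) :
  a < t < b -> derivable_within `[a, b] f t ->
  is_derive t 1 f (derive_within `[a, b] f t).
Proof.
move=> tab; rewrite /derivable_within /derive_within (dnbhs_within_itv a b t tab).
move=> /cvg_ex[/= l fl].
rewrite (cvg_lim _ fl)//.
have fl' : h^-1 *: ((f \o shift t) (h *: 1) - f t) @[h --> 0^'] --> l.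
  have := cvg_comp _ _ (cvg_shift_dnbhs t) fl.
  rewrite (_ : diff_quot f t \o (fun h => h + t) =
    (fun h : R => h^-1 *: ((f \o shift t) (h *: 1) - f t)))//.
  apply/funext => h; rewrite /diff_quot /= addrK.
  by rewrite -[h *: 1]/(h * 1) mulr1.
apply: DeriveDef; first by apply/cvg_ex; exists l.
exact: cvg_lim fl'.
Qed.

Lemma derivable_within_lipschitz {R : realType} (A : set R) (f : R -> R) (t : R) :
  derivable_within A f t ->
  exists K d, 0 < d /\ forall s, A s -> `|t - s| < d ->
    `|f t - f s| <= K * `|t - s|.
Proof.
move=> /cvg_ex[/= l /cvgrPdist_lt/(_ 1 ltr01)].
move=> /nbhs_ballP[d d0 h]; exists (`|l| + 1), d; split => // s As ts.
have [->|st] := eqVneq s t; first by rewrite !subrr normr0 mulr0.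
have st0 : s - t != 0 by rewrite subr_eq0.
have := h s ts st As; rewrite /diff_quot => H.
rewrite -(distrC s t) -ler_pdivrMr ?normr_gt0// -(distrC (f s)) -normrV ?unitfE//.
rewrite -normrM [_ * _^-1]mulrC -(subrK l (_ * _)) (le_trans (ler_normD _ _))//.
by rewrite addrC lerD2l distrC ltW.
Qed.

Lemma base_vec_ball {R : realType} (n : nat) (i : 'I_n) (x : 'rV[R]_n) (s s' d : R) :
  0 < d -> `|s - s'| < d -> ball (x + s *: base_vec R i) d (x + s' *: base_vec R i).
Proof.
move=> d0 ss'; split => // k j; rewrite /ball/= !mxE opprD addrACA subrr add0r -mulrBl normrM.
case: (_ && _); first by rewrite normr1 mulr1.
by rewrite normr0 mulr0.
Qed.

(** For functions that are C^2 in x, jointly continuously in (x, t), second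
differences are approximated by second derivatives uniformly in t in a compact
interval: the second derivative is uniformly continuous on the product of a
small segment in the direction i with [a, b]. Uniformity in t is what allows
the integration in time. *)
Lemma second_difference_near {R : realType} (n : nat) (G : set 'rV[R]_n)
    (T a b e : R) (D : R -> 'rV[R]_n -> R) (x : 'rV[R]_n) (i : 'I_n) :
  open G -> G x -> 1 < a -> b <= T -> 0 < e ->
  (forall (s : seq 'I_n) (i : 'I_n) x t, (size s < 2)%N -> Omega G T (x, t) ->
     derivable (partials s (D t)) x (base_vec R i)) ->
  (forall s : seq 'I_n, (size s <= 2)%N ->
     {within Omega G T, continuous (fun p => partials s (D p.2) p.1)}) ->
  \forall h \near 0^'+,
    (forall s, `|s| <= h -> G (x + s *: base_vec R i)) /\
    forall t, t \in `[a, b] ->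
      `|D t (x + h *: base_vec R i) + D t (x - h *: base_vec R i) - D t x *+ 2
        - partials [:: i; i] (D t) x * h ^+ 2| <= e * h ^+ 2.
Proof.
move=> oG Gx a1 bT e0 dD cD.
have /nbhs_ballP[r /= r0 xr] : nbhs x G by exact: open_nbhs_nbhs.
pose r2 := r / 2; have r20 : 0 < r2 by rewrite divr_gt0.
have Gline s : `|s| <= r2 -> G (x + s *: base_vec R i).
  move=> sr; apply: xr; rewrite -[X in ball X](addr0 x) -(scale0r (base_vec R i)).
  apply: base_vec_ball => //; rewrite sub0r normrN (le_lt_trans sr)//.
  by rewrite /r2 ltr_pdivrMr// ltr_pMr// ltr1n.
pose P (p : R * R) := partials [:: i; i] (D p.2) (x + p.1 *: base_vec R i).
pose A : set (R * R) := `[- r2, r2] `*` `[a, b].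
have AO p : A p -> Omega G T (x + p.1 *: base_vec R i, p.2).
  case: p => s t [/=]; rewrite !in_itv/= => sr /andP[at' tb]; split => /=.
    by apply: Gline; rewrite ler_norml.
  by rewrite in_itv/= (lt_le_trans a1)// (le_trans tb).
have cA : compact A by apply: compact_setX; exact: segment_compact.
have cP : {within A, continuous P}.
  have /within_continuousP cD2 := cD [:: i; i] isT.
  apply/within_continuousP => p Ap e' e'0.
  have [d d0 h] := cD2 _ (AO p Ap) e' e'0.
  exists d => // p' Ap' [/= b1 b2]; apply: (h (x + p'.1 *: base_vec R i, p'.2)).
    exact: AO.
  by split => //=; apply: base_vec_ball.
have [d d0 uc] := compact_uniform_continuity A P cA cP e e0.
near=> h.
have h0 : 0 < h by near: h; exact: nbhs_right_gt.
have hr : h <= r2 by near: h; exact: nbhs_right_le.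
have hd : h < d by near: h; exact: nbhs_right_lt.
split=> [s sh|t tab]; first by apply: Gline; exact: le_trans hr.
have sr s : s \in `[- h, h] -> `|s| <= r2.
  by rewrite in_itv/= -ler_norml => /le_trans; apply.
have At s : s \in `[- h, h] -> A (s, t).
  by move=> sh; split => //=; rewrite in_itv/= -ler_norml sr.
have z0 : 0 \in `[- h, h] by rewrite in_itv/= oppr_le0 ltW.
have close s : s \in `[- h, h] -> `|P (0, t) - P (s, t)| <= e.
  move=> sh; apply/ltW/uc; [exact: At|exact: At|split => /=; last exact: ballxx].
  rewrite /ball/= sub0r normrN (le_lt_trans _ hd)// ler_norml.
  by move: sh; rewrite in_itv.
pose g s := D t (x + s *: base_vec R i).
pose g1 s := partials [:: i] (D t) (x + s *: base_vec R i).
have dg s : s \in `[- h, h] -> is_derive s 1 g (g1 s).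
  move=> sh; apply: (is_derive_line (D t)).
  exact: (dD [::] i _ _ isT (AO _ (At _ sh))).
have dg1 s : s \in `[- h, h] -> is_derive s 1 g1 (P (s, t)).
  move=> sh; apply: (is_derive_line (partials [:: i] (D t))).
  exact: (dD [:: i] i _ _ isT (AO _ (At _ sh))).
have H1 := second_difference_ge g g1 (fun s => P (s, t)) (P (0, t) - e) h h0 dg dg1.
have H2 := second_difference_ge (fun s => - g s) (fun s => - g1 s)
  (fun s => - P (s, t)) (- P (0, t) - e) h h0
  (fun s sh => is_deriveN (dg s sh)) (fun s sh => is_deriveN (dg1 s sh)).
have {}H1 : (P (0, t) - e) * h ^+ 2 <= g h + g (- h) - g 0 *+ 2.
  by apply: H1 => s /close; rewrite ler_distlC => /andP[].
have {}H2 : (- P (0, t) - e) * h ^+ 2 <= - g h + - g (- h) - (- g 0) *+ 2.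
  by apply: H2 => s /close; rewrite ler_distlC -opprD lerN2 => /andP[].
have -> : 'D_(base_vec R i) ('D_(base_vec R i) (D t)) x = P (0, t).
  by rewrite /P/= scale0r addr0.
have -> : D t x = g 0 by rewrite /g scale0r addr0.
rewrite -/(g h) -scaleNr -/(g (- h)).
move: H1 H2; rewrite ler_norml mulrBl mulrBl mulNr mulNrn.
move: (g h) (g (- h)) (g 0) (P (0, t) * _) (e * _) => u1 u2 u3 u4 u5.
clear => H1 H2; apply/andP; split; lra.
Unshelve. all: end_near. Qed.

(** * Classical solutions *)

Lemma slice_time_continuous {R : realType} {S : pseudoMetricType R} (X : set S)
    (I : set R) (v : S -> R -> R) (x : S) : X x ->
  {within X `*` I, continuous (fun p => v p.1 p.2)} ->
  {within I, continuous (v x)}.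
Proof.
move=> Xx /within_continuousP cv; apply/within_continuousP => t It e e0.
have [d d0 h] := cv (x, t) (conj Xx It) e e0.
exists d => // s Is ts; apply: (h (x, s)) => //.
by split => //=; exact: ballxx.
Qed.

Lemma slice_space_continuous {R : realType} {S : pseudoMetricType R} (X : set S)
    (I : set R) (v : S -> R -> R) (t : R) : I t ->
  {within X `*` I, continuous (fun p => v p.1 p.2)} ->
  {within X, continuous (v ^~ t)}.
Proof.
move=> It /within_continuousP cv; apply/within_continuousP => x Xx e e0.
have [d d0 h] := cv (x, t) (conj Xx It) e e0.
exists d => // y Xy xy; apply: (h (y, t)) => //.
by split => //=; exact: ballxx.
Qed.

(** Continuity in t is known for each fixed x, and uniform continuity of v makes
the integral continuous in x uniformly in t. *)
Lemma had_joint_continuous {R : realType} {S : pseudoMetricType R} (X : set S)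
    (b l T : R) (v : S -> R -> R) : 0 < b -> compact X ->
  {within X `*` `[1, T], continuous (fun p => v p.1 p.2)} ->
  {within X `*` `[l, T], continuous (fun p => had b 1 (v p.1) p.2)}.
Proof.
move=> b0 cX cv.
have uc := compact_uniform_continuity _ _ (compact_setX cX (@segment_compact R 1 T)) cv.
apply/within_continuousP => -[x t] [/= Xx tI] e e0.
have tT : t <= T by move: tI; rewrite in_itv/= => /andP[].
have cvx := slice_time_continuous X `[1, T] v x Xx cv.
have ch := had_continuous_extended b l T (v x) b0 cvx.
have e20 : 0 < e / 2 by rewrite divr_gt0.
have [d1 d10 h1] := (within_continuousP _ _).1 ch t tI _ e20.
pose L := ln T `^ b / b.
have L0 : 0 <= L by rewrite divr_ge0 ?powR_ge0// ltW.
have L1 : 0 < L + 1 by rewrite ltr_wpDl.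
have [d2 d20 h2] := uc (e / 2 / (L + 1)) (divr_gt0 e20 L1).
exists (Num.min d1 d2); first by rewrite lt_min d10.
move=> [y s] [/= Xy sI] [/= xy ts].
have sT : s <= T by move: sI; rewrite in_itv/= => /andP[].
have ts1 : ball t d1 s by apply: le_ball ts; rewrite ge_min lexx.
have xy2 : ball x d2 y by apply: le_ball xy; rewrite ge_min lexx orbT.
rewrite -(subrKA (had b 1 (v x) s)) (le_lt_trans (ler_normD _ _))//.
rewrite [ltRHS]splitr ltr_leD//; first exact: h1.
have [s1|s1] := leP s 1.
  by rewrite !(had_degenerate b 1 s)// subrr normr0 ltW.
have cvy := slice_time_continuous X `[1, T] v y Xy cv.
have sub (f : R -> R) : {within `[1, T], continuous f} -> {within `[1, s], continuous f}.
  by apply: continuous_subspaceW; apply: subset_itv; rewrite bnd_simp.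
rewrite -(hadB b 1 s b0 ltr01 (v x) (v y) (sub _ cvx) (sub _ cvy)).
have cxy : {within `[1, s], continuous (fun r => v x r - v y r)}.
  by move=> r; apply: cvgB; [exact: (sub _ cvx)|exact: (sub _ cvy)].
have H : {in `[1, s], forall r, `|v x r - v y r| <= e / 2 / (L + 1)}.
  move=> r; rewrite in_itv/= => /andP[r1 rs]; apply/ltW.
  have rI : `[1, T]%classic r by rewrite /= in_itv/= r1 (le_trans rs).
  apply: (h2 (x, r) (y, r)) => //.
  by split => //=; exact: ballxx.
rewrite (le_trans (had_norm_le b 1 s b0 ltr01 _ _ (ltW s1) cxy H))//.
rewrite divr1; apply: (@le_trans _ _ (e / 2 / (L + 1) * (L + 1))); last first.
  by rewrite divfK// gt_eqF.
rewrite ler_pM2l ?divr_gt0//; apply: (@le_trans _ _ L); last by rewrite lerDl.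
have s0 : 0 < s by exact: lt_trans s1.
rewrite /L ler_pM2r ?invr_gt0//; apply: (ge0_ler_powR (ltW b0)); rewrite ?nnegrE.
- by rewrite ln_ge0// ltW.
- by rewrite ln_ge0// (le_trans (ltW s1)).
- by rewrite ler_ln// posrE (lt_le_trans s0).
Qed.

Definition sqnorm {R : realType} {n : nat} (z : 'rV[R]_n) : R := \sum_i z 0 i ^+ 2.

Lemma sqnorm_second_difference {R : realType} {n : nat} (z : 'rV[R]_n) (i : 'I_n)
    (h : R) :
  sqnorm (z + h *: base_vec R i) + sqnorm (z - h *: base_vec R i) - sqnorm z *+ 2
  = 2 * h ^+ 2.
Proof.
rewrite /sqnorm -big_split/= -sumrMnl -sumrB (bigD1 i)//= big1 ?addr0.
  by rewrite !mxE !eqxx/=; ring.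
by move=> j ji; rewrite !mxE/= (negbTE ji) !mulr0 subr0 addr0 mulr2n subrr.
Qed.

Lemma bdry_closureD {R : realType} (n : nat) (G : set 'rV[R]_n) (x : 'rV[R]_n) :
  open G -> closure G x -> G x \/ bdry G x.
Proof.
move=> oG clx; have [Gx|nGx] := pselect (G x); [by left|right].
by split => //; rewrite (interior_id _).1.
Qed.

Section solution.
Context {R : realType} (n : nat) (G : set 'rV[R]_n) (T alpha nu : R).
Context (F v : 'rV[R]_n -> R -> R).
Hypotheses (oG : open G) (alpha0 : 0 < alpha) (nu0 : 0 < nu).
Hypothesis sol : classical_solution G T alpha nu F v.

Lemma solution_time_continuous x : closure G x -> {within `[1, T], continuous (v x)}.
Proof. by move=> Gx; exact: slice_time_continuous Gx (sol_continuous sol). Qed.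

Lemma solution_is_derive x t : G x -> 1 < t < T ->
  is_derive t 1 (v x) (derive_within `[1, T] (v x) t).
Proof.
move=> Gx tI; apply: derivable_within_is_derive => //.
apply: (sol_dt sol); split => //=.
by move: tI => /andP[t1 tT]; rewrite in_itv/= t1 ltW.
Qed.

Lemma solution_hadamard_is_derive x t : G x -> 1 < t < T ->
  is_derive t 1 (hadamard_int alpha (v x)) (t^-1 * hadamard_deriv T alpha (v x) t).
Proof.
move=> Gx tI; have /andP[t1 tT] := tI.
have d := derivable_within_is_derive 1 T t (hadamard_int alpha (v x)) tI.
have O : Omega G T (x, t) by split => //=; rewrite in_itv/= t1 ltW.
apply: (is_derive_eq (d (sol_hadamard sol O))).
by rewrite /hadamard_deriv mulrA mulVf ?mul1r// gt_eqF// (lt_trans _ t1).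
Qed.

Lemma solution_hadamard_continuous x : closure G x ->
  {within `[1, T], continuous (hadamard_int alpha (v x))}.
Proof.
move=> Gx.
apply: (@subspace_eq_continuous _ _ _ (fun t => (Gamma alpha)^-1 * had alpha 1 (v x) t)).
  by move=> t _; rewrite /from_subspace/= hadamard_intE.
have ch := had_continuous alpha T (v x) alpha0 (solution_time_continuous x Gx).
by move=> t; apply: cvgM; [exact: cvg_cst|exact: ch].
Qed.

(** The discrete Laplacian with step h, not divided by h ^+ 2. Working with it
avoids exchanging derivatives in x with the integral in t: the Hadamard
integral of a solution is not known to be differentiable in x, only its
Hadamard derivative is. *)
Definition spatial_difference (f : 'rV[R]_n -> R) (x : 'rV[R]_n) (h : R) : R :=
  \sum_i (f (x + h *: base_vec R i) + f (x - h *: base_vec R i) - f x *+ 2).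

Lemma spatial_difference_is_derive x h t : 0 < h ->
  (forall i s, `|s| <= h -> G (x + s *: base_vec R i)) -> 1 < t < T ->
  is_derive t 1 (fun t => spatial_difference (fun y => hadamard_int alpha (v y) t) x h)
    (t^-1 * spatial_difference (fun y => hadamard_deriv T alpha (v y) t) x h).
Proof.
move=> h0 Gh tI; rewrite /spatial_difference.
pose f (i : 'I_n) (t : R) := hadamard_int alpha (v (x + h *: base_vec R i)) t +
  hadamard_int alpha (v (x - h *: base_vec R i)) t - hadamard_int alpha (v x) t *+ 2.
have -> : (fun t => \sum_(i < n) (hadamard_int alpha (v (x + h *: base_vec R i)) t +
    hadamard_int alpha (v (x - h *: base_vec R i)) t -
    hadamard_int alpha (v x) t *+ 2)) = \sum_(i < n) f i.
  by apply/funext => s; rewrite fct_sumE.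
rewrite mulr_sumr; apply: is_derive_sum => i.
have G1 : G (x + h *: base_vec R i) by apply: Gh; rewrite gtr0_norm.
have G2 : G (x - h *: base_vec R i).
  by rewrite -scaleNr; apply: Gh; rewrite normrN gtr0_norm.
have G0 : G x by have := Gh i 0; rewrite scale0r addr0; apply; rewrite normr0 ltW.
have d1 := solution_hadamard_is_derive _ _ G1 tI.
have d2 := solution_hadamard_is_derive _ _ G2 tI.
have d0 := solution_hadamard_is_derive _ _ G0 tI.
have d := is_deriveB (is_deriveD d1 d2) (is_deriveD d0 d0).
rewrite /f mulr2n mulrBr mulrDr mulrDr; exact: d.
Qed.

Lemma spatial_difference_continuous x h : 0 < h ->
  (forall i s, `|s| <= h -> G (x + s *: base_vec R i)) ->
  {within `[1, T], continuous
    (fun t => spatial_difference (fun y => hadamard_int alpha (v y) t) x h)}.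
Proof.
move=> h0 Gh t; rewrite /spatial_difference; apply: (cvg_big add_continuous) => i _.
have G1 : G (x + h *: base_vec R i) by apply: Gh; rewrite gtr0_norm.
have G2 : G (x - h *: base_vec R i).
  by rewrite -scaleNr; apply: Gh; rewrite normrN gtr0_norm.
have G0 : G x by have := Gh i 0; rewrite scale0r addr0; apply; rewrite normr0 ltW.
have c1 := solution_hadamard_continuous _ (@subset_closure _ G _ G1).
have c2 := solution_hadamard_continuous _ (@subset_closure _ G _ G2).
have c0 := solution_hadamard_continuous _ (@subset_closure _ G _ G0).
apply: cvgB; first by apply: cvgD; [exact: c1|exact: c2].
by apply: cvgMn; exact: c0.
Qed.

(** The equation in discrete form: as h tends to 0, nu times the discrete
Laplacian of the Hadamard derivative is h ^+ 2 * (v_t - F), with an error that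
is small with respect to h ^+ 2 uniformly in t. *)
Lemma spatial_difference_near x a b e : G x -> 1 < a -> b <= T -> 0 < e ->
  \forall h \near 0^'+,
    (forall i s, `|s| <= h -> G (x + s *: base_vec R i)) /\
    forall t, t \in `[a, b] ->
      `|nu * spatial_difference (fun y => hadamard_deriv T alpha (v y) t) x h
        - h ^+ 2 * (derive_within `[1, T] (v x) t - F x t)| <= e * h ^+ 2.
Proof.
move=> Gx a1 bT e0; have [dD cD] := sol_C2x sol.
pose e' := e / (nu * n.+1%:R).
have e'0 : 0 < e' by rewrite divr_gt0// mulr_gt0.
have H i := second_difference_near n G T a b e'
  (fun t y => hadamard_deriv T alpha (v y) t) x i oG Gx a1 bT e'0 dD cD.
have FF : Filter (0^'+ : set_system R) by exact: _.
have HF := filter_forall FF H.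
apply: filterS HF => h hh.
split => [i s|t tab].
  by have [+ _] := hh i; exact.
have [t1 tT] : 1 < t /\ t <= T.
  by move: tab; rewrite in_itv/= => /andP[at' tb];
    rewrite (lt_le_trans a1 at') (le_trans tb bT).
rewrite (sol_equation sol); last by split => //=; rewrite in_itv/= t1.
rewrite addrK mulrCA -mulrBr normrM gtr0_norm// /laplacian mulr_sumr /spatial_difference -sumrB.
rewrite (le_trans (ler_wpM2l (ltW nu0) (ler_norm_sum _ _ _)))//.
apply: (@le_trans _ _ (nu * \sum_(i < n) e' * h ^+ 2)).
  rewrite ler_pM2l//; apply: ler_sum => i _.
  by have [_ /(_ t tab)] := hh i; rewrite [h ^+ 2 * _]mulrC.
have E1 : nu * (n%:R * e') <= e.
  have -> : nu * (n%:R * e') = e * (n%:R / n.+1%:R).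
    have m0 : n.+1%:R != 0 :> R by rewrite pnatr_eq0.
    by rewrite /e'; move: (n.+1%:R : R) m0 => m m0; field; rewrite m0 gt_eqF.
  by rewrite ler_piMr ?(ltW e0)// ler_pdivrMr ?ltr0n// mul1r ler_nat.
rewrite sumr_const card_ord.
have -> : nu * (e' * h ^+ 2 *+ n) = nu * (n%:R * e') * h ^+ 2.
  by rewrite -mulr_natl; clearbody e'; ring.
by rewrite ler_wpM2r// exprn_even_ge0.
Qed.

End solution.

(** * Maximum principle in space for the difference of two solutions *)

Lemma spatial_differenceB {R : realType} (n : nat) (f g : 'rV[R]_n -> R)
    (x : 'rV[R]_n) (h : R) :
  spatial_difference n (fun y => f y - g y) x h =
  spatial_difference n f x h - spatial_difference n g x h.
Proof.
rewrite /spatial_difference -sumrB; apply: eq_bigr => i _.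
move: (f _) (g _) (f _) (g _) (f _) (g _) => a b c d e k; ring.
Qed.

Lemma eq_spatial_difference {R : realType} (n : nat) (f g : 'rV[R]_n -> R)
    (x : 'rV[R]_n) (h : R) (G : set 'rV[R]_n) : 0 < h ->
  (forall i s, `|s| <= h -> G (x + s *: base_vec R i)) ->
  (forall y, G y -> f y = g y) ->
  spatial_difference n f x h = spatial_difference n g x h.
Proof.
move=> h0 Gh fg; apply: eq_bigr => i _.
have G1 : G (x + h *: base_vec R i) by apply: Gh; rewrite gtr0_norm.
have G2 : G (x - h *: base_vec R i).
  by rewrite -scaleNr; apply: Gh; rewrite normrN gtr0_norm.
have G0 : G x by have := Gh i 0; rewrite scale0r addr0; apply; rewrite normr0 ltW.
by rewrite !fg.
Qed.

Lemma eq_ler {R : realType} (x y : R) : x = y -> x <= y.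
Proof. by move=> ->. Qed.

Section two_solutions.
Context {R : realType} (n : nat) (G : set 'rV[R]_n) (T alpha nu : R).
Context (F u ubar : 'rV[R]_n -> R -> R).
Hypotheses (oG : open G) (alpha0 : 0 < alpha) (nu0 : 0 < nu) (T1 : 1 < T).
Hypotheses (solu : classical_solution G T alpha nu F u)
           (solub : classical_solution G T alpha nu F ubar).

Definition solution_gap (x : 'rV[R]_n) (t : R) : R := u x t - ubar x t.

Local Notation w := solution_gap.
Local Notation Hw x := (hadamard_int alpha (w x)).

Lemma gap_continuous : {within closure G `*` `[1, T], continuous (fun p => w p.1 p.2)}.
Proof.
by move=> p; apply: cvgB; [exact: (sol_continuous solu)|exact: (sol_continuous solub)].
Qed.

Lemma gap_time_continuous x : closure G x -> {within `[1, T], continuous (w x)}.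
Proof. by move=> Gx; exact: slice_time_continuous Gx gap_continuous. Qed.

Lemma hadamard_gap x t : closure G x -> t <= T ->
  Hw x t = hadamard_int alpha (u x) t - hadamard_int alpha (ubar x) t.
Proof.
move=> Gx tT; rewrite !hadamard_intE -mulrBr; congr (_ * _).
by apply: (hadB alpha 1 t alpha0 ltr01 (u x) (ubar x));
  [have := solution_time_continuous n G T alpha nu F u solu x Gx
  |have := solution_time_continuous n G T alpha nu F ubar solub x Gx];
  apply: continuous_subspaceW; apply: subset_itv; rewrite bnd_simp.
Qed.

(** The space part of the maximum principle. Suppose that, up to a quadratic
penalty, the increment of the Hadamard integral from time a to time b is
maximal at x0; then its discrete Laplacian at x0 is at most
2 * c * n * h ^+ 2. On the other hand the Hadamard integral has the time
derivative D / t, where D is the Hadamard derivative, and w_t = nu * Laplacian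
of D. So nu times the increment of the discrete Laplacian is h ^+ 2 times the
integral of w_t / t over [a, b], up to a small error. Integrating by parts
replaces w_t / t by the derivative of (w - w(b)) / t; the remaining term is
controlled by the oscillation om of w. *)
Lemma spatial_max (x0 x1 : 'rV[R]_n) (a b c om : R) :
  G x0 -> 1 < a -> a <= b -> b <= T ->
  (forall y, G y -> Hw y b - Hw y a - c * sqnorm (y - x1) <=
     Hw x0 b - Hw x0 a - c * sqnorm (x0 - x1)) ->
  {in `[a, b], forall t, `|w x0 t - w x0 b| <= om} ->
  (w x0 b - w x0 a) / a <= om * (a^-1 - b^-1) + 2 * c * n%:R * nu.
Proof.
move=> Gx0 a1 ab bT Hmax Hom.
have [gH gHE] : exists gH, gH = fun y => Hw y b - Hw y a by exists (fun y => Hw y b - Hw y a).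
have {}Hmax y : G y -> gH y - c * sqnorm (y - x1) <= gH x0 - c * sqnorm (x0 - x1).
  by rewrite gHE; exact: Hmax.
apply/ler_addgt0Pr => e e0.
have a0 : 0 < a by exact: lt_trans a1.
have b0 : 0 < b by exact: lt_le_trans ab.
have ba1 : 0 < 2 * (b - a) + 1 by rewrite ltr_wpDl// mulr_ge0// subr_ge0.
pose e1 := e / (2 * (b - a) + 1).
have e10 : 0 < e1 by rewrite divr_gt0.
have N1 := spatial_difference_near n G T alpha nu F u oG nu0 solu x0 a b e1
  Gx0 a1 bT e10.
have N2 := spatial_difference_near n G T alpha nu F ubar oG nu0 solub x0 a b e1
  Gx0 a1 bT e10.
have [h [[[Gh A1] [_ A2]] h0]] := filter_ex (filterI (filterI N1 N2) (nbhs_right_gt (0 : R))).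
rewrite {N1 N2}.
have subG := @subset_closure _ G.
pose SD (v : 'rV[R]_n -> R -> R) (t : R) :=
  spatial_difference n (fun y => hadamard_int alpha (v y) t) x0 h.
pose SDD (v : 'rV[R]_n -> R -> R) (t : R) :=
  spatial_difference n (fun y => hadamard_deriv T alpha (v y) t) x0 h.
pose wd (t : R) := derive_within `[1, T] (u x0) t - derive_within `[1, T] (ubar x0) t.
(* Psi is nondecreasing: the derivative of its first term is h ^+ 2 * w_t / t up
   to the error 2 * e1 * h ^+ 2, and adding om makes w - w(b) + om nonnegative,
   so that differentiating 1/t only helps. *)
pose Psi (t : R) := nu * (SD u t - SD ubar t) +
  h ^+ 2 * (2 * e1 * t - (w x0 t - w x0 b + om) * t^-1).
pose dPsi (t : R) := nu * (t^-1 * SDD u t - t^-1 * SDD ubar t) +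
  h ^+ 2 * (2 * e1 - (wd t * t^-1 - (w x0 t - w x0 b + om) * (t^-1 ^+ 2))).
have inT t : t \in `]a, b[ -> 1 < t < T.
  rewrite in_itv/= => /andP[at' tb].
  by rewrite (lt_trans a1 at') (lt_le_trans tb bT).
have dP t : t \in `]a, b[ -> is_derive t 1 Psi (dPsi t).
  move=> /inT tI; have t0 : t != 0.
    by move: tI => /andP[t1 _]; rewrite gt_eqF// (lt_trans _ t1).
  have d1 := spatial_difference_is_derive n G T alpha nu F u solu x0 h t h0 Gh tI.
  have d2 := spatial_difference_is_derive n G T alpha nu F ubar solub x0 h t h0 Gh tI.
  have d12 : is_derive t 1 (fun t => nu * (SD u t - SD ubar t))
      (nu *: (t^-1 * SDD u t - t^-1 * SDD ubar t)).
    exact: (is_deriveZ nu (is_deriveB d1 d2)).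
  have d3 := solution_is_derive n G T alpha nu F u solu x0 t Gx0 tI.
  have d4 := solution_is_derive n G T alpha nu F ubar solub x0 t Gx0 tI.
  have d5 : is_derive t 1 (fun t => w x0 t - w x0 b + om) (wd t - 0 + 0).
    exact: (is_deriveD (is_deriveB (is_deriveB d3 d4) (is_derive_cst _ _ _))
      (is_derive_cst _ _ _)).
  have d6 : is_derive t 1 (fun t : R => t^-1) (- t ^- 2 *: 1).
    exact: (is_deriveV t0 (is_derive_id t (1 : R))).
  have d7 : is_derive t 1 (fun t => (w x0 t - w x0 b + om) * t^-1)
     ((w x0 t - w x0 b + om) *: (- t ^- 2 *: 1) + t^-1 *: (wd t - 0 + 0)).
    exact: (is_deriveM d5 d6).
  have d8 : is_derive t 1 (fun t : R => 2 * e1 * t) ((2 * e1) *: 1).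
    exact: (is_deriveZ (2 * e1) (is_derive_id t (1 : R))).
  have d9 := is_deriveD d12 (is_deriveZ (h ^+ 2) (is_deriveB d8 d7)).
  apply: (is_derive_eq d9); rewrite /dPsi /GRing.scale/= exprVn.
  move: (SDD u t) (SDD ubar t) (w x0 t) (wd t) => r1 r2 r3 r4; ring.
have cPsi : {within `[a, b], continuous Psi}.
  have sub : `[a, b] `<=` `[1, T] by apply: subset_itv; rewrite bnd_simp// ltW.
  have c1 := continuous_subspaceW sub
    (spatial_difference_continuous n G T alpha nu F u alpha0 solu x0 h h0 Gh).
  have c2 := continuous_subspaceW sub
    (spatial_difference_continuous n G T alpha nu F ubar alpha0 solub x0 h h0 Gh).
  have c3 := continuous_subspaceW sub (gap_time_continuous x0 (subG _ Gx0)).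
  have c4 : {within `[a, b], continuous (fun t : R => t^-1)}.
    apply: continuous_in_subspaceT => t; rewrite inE/= in_itv/= => /andP[at' _].
    by apply: inv_continuous; rewrite gt_eqF// (lt_le_trans a0).
  have c5 : {within `[a, b], continuous (fun t : R => t)}.
    by apply: continuous_subspaceT => t; exact: cvg_id.
  move=> t; apply: cvgD; first apply: cvgM; first exact: cvg_cst.
    by apply: cvgB; [exact: c1|exact: c2].
  apply: cvgM; first exact: cvg_cst.
  apply: cvgB; first by apply: cvgM; [exact: cvg_cst|exact: c5].
  apply: cvgM; last exact: c4.
  apply: cvgD; last exact: cvg_cst.
  by apply: cvgB; [exact: c3|exact: cvg_cst].
have pos : {in `]a, b[, forall t, 0 <= dPsi t}.
  move=> t tI; have tab : t \in `[a, b].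
    by move: tI; apply: subset_itv; rewrite bnd_simp.
  have := A1 t tab; have := A2 t tab; rewrite -/(SDD u t) -/(SDD ubar t).
  rewrite !ler_norml => /andP[_ B2] /andP[B1 _].
  have B : h ^+ 2 * wd t - 2 * e1 * h ^+ 2 <= nu * (SDD u t - SDD ubar t).
    rewrite /wd; move: B1 B2.
    move: (SDD u t) (SDD ubar t) (derive_within _ (u x0) t) => r1 r2 r3.
    move: (derive_within _ (ubar x0) t) (F x0 t) => r4 r5; lra.
  have /andP[t1 tT] := inT _ tI.
  have t0 : 0 < t by exact: lt_trans t1.
  have i0 : 0 < t^-1 by rewrite invr_gt0.
  have i1 : t^-1 <= 1 by rewrite invf_le1// ltW.
  have h20 : 0 < h ^+ 2 by rewrite exprn_gt0.
  have W0 : 0 <= w x0 t - w x0 b + om.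
    have := Hom t tab; rewrite ler_norml => /andP[H _].
    by rewrite -(addNr om) lerD2r.
  have -> : dPsi t = t^-1 * (nu * (SDD u t - SDD ubar t) -
      (h ^+ 2 * wd t - 2 * e1 * h ^+ 2)) + h ^+ 2 * (2 * e1 * (1 - t^-1)) +
      h ^+ 2 * ((w x0 t - w x0 b + om) * t^-1 ^+ 2).
    rewrite /dPsi; move: (SDD u t) (SDD ubar t) (w x0 t) (wd t) => r1 r2 r3 r4; ring.
  apply: addr_ge0; first apply: addr_ge0.
  - by apply: mulr_ge0; [exact: ltW|rewrite subr_ge0].
  - apply: mulr_ge0; first exact: ltW.
    by apply: mulr_ge0; [rewrite mulr_ge0// ltW|rewrite subr_ge0].
  - apply: mulr_ge0; first exact: ltW.
    by apply: mulr_ge0 => //; rewrite exprn_ge0// ltW.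
have := ge0_is_derive_le Psi dPsi a b ab dP cPsi pos.
have SDb : SD u b - SD ubar b - (SD u a - SD ubar a) <= 2 * c * n%:R * h ^+ 2.
  have aT : a <= T by exact: le_trans bT.
  have Gp i : G (x0 + h *: base_vec R i) by apply: Gh; rewrite gtr0_norm.
  have Gm i : G (x0 - h *: base_vec R i).
    by rewrite -scaleNr; apply: Gh; rewrite normrN gtr0_norm.
  have SDE t : t <= T -> SD u t - SD ubar t = spatial_difference n (fun y => Hw y t) x0 h.
    move=> tT; rewrite /SD -spatial_differenceB.
    apply: (@eq_spatial_difference R n _ _ x0 h G h0 Gh) => y Gy.
    by rewrite hadamard_gap//; exact: subG.
  have E := spatial_differenceB n (fun y => Hw y b) (fun y => Hw y a) x0 h.
  have Eb := SDE b bT; have Ea := SDE a aT.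
  have EE := etrans (f_equal2 (fun p q : R => p - q) Eb Ea) (esym E).
  apply: (le_trans (eq_ler _ _ EE)) => {E Eb Ea EE}; rewrite -gHE.
  apply: (@le_trans _ _ (\sum_(i < n) (c * (2 * h ^+ 2)))); last first.
    rewrite sumr_const card_ord -mulr_natl le_eqVlt; apply/orP; left; apply/eqP; ring.
  apply: ler_sum => i _.
  rewrite -(sqnorm_second_difference (x0 - x1) i h).
  have H1 := Hmax _ (Gp i); have H2 := Hmax _ (Gm i).
  rewrite (addrAC x0) in H1; rewrite (addrAC x0) in H2.
  rewrite mulrBr mulrDr mulrnAr; move: H1 H2.
  move: (c * sqnorm (x0 - x1 + _)) (c * sqnorm (x0 - x1 - _)) (c * sqnorm (x0 - x1)).
  move: (gH (x0 + _)) (gH (x0 - _)) (gH x0) => g1 g2 g3 q1 q2 q3.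
  lra.
rewrite /Psi; move: SDb.
generalize (SD u b) (SD ubar b) (SD u a) (SD ubar a) (w x0 b) (w x0 a).
move=> s1 s2 s3 s4 wb wa SDb Hab; have h20 : 0 < h ^+ 2 by rewrite exprn_gt0.
have nuS : nu * (s1 - s2) - nu * (s3 - s4) <= h ^+ 2 * (2 * c * n%:R * nu).
  rewrite -mulrBr (le_trans (ler_wpM2l (ltW nu0) SDb))//.
  by apply: eq_ler; ring.
have {Hab nuS SDb} : h ^+ 2 * ((wb - wa) / a) <=
    h ^+ 2 * (om * (a^-1 - b^-1) + 2 * c * n%:R * nu + 2 * e1 * (b - a)).
  move: Hab nuS; rewrite subrr add0r.
  generalize (nu * (s1 - s2)) (nu * (s3 - s4)) (2 * c * n%:R * nu) a^-1 b^-1 (h ^+ 2).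
  by move=> nA nB K ia ib h2; lra.
rewrite ler_pM2l// => /le_trans; apply; rewrite lerD2l.
have -> : e = e1 * (2 * (b - a) + 1) by rewrite /e1 divfK// gt_eqF.
apply: (@le_trans _ _ (e1 * (2 * (b - a)))).
  by apply: eq_ler; clearbody e1; ring.
by rewrite ler_pM2l// lerDl.
Qed.

End two_solutions.

Lemma sqnorm_continuous {R : realType} (n : nat) (x0 : 'rV[R]_n) :
  continuous (fun y : 'rV[R]_n => sqnorm (y - x0)).
Proof.
move=> y; have FF : Filter (nbhs y) by exact: _.
have c i : (fun z : 'rV[R]_n => z 0 i - x0 0 i) @ nbhs y --> y 0 i - x0 0 i.
  have ci : {for y, continuous (fun z : 'rV[R]_n => z 0 i)} by exact: coord_continuous.
  exact: (@cvgB R R^o _ (nbhs y) FF _ _ _ _ ci (@cvg_cst R (x0 0 i) _ (nbhs y) FF)).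
have c2 i := @cvgM _ _ (nbhs y) FF _ _ _ _ (c i) (c i).
have E : (fun z => sqnorm (z - x0)) =
    (fun z => \sum_i (z 0 i - x0 0 i) * (z 0 i - x0 0 i)).
  by apply/funext => z; apply: eq_bigr => i _; rewrite !mxE expr2.
rewrite /continuous_at E (f_equal (fun f => f y) E : sqnorm (y - x0) = _).
by apply: (cvg_big add_continuous) => i _; exact: c2.
Qed.

Lemma sqnorm_lt_ball {R : realType} (n : nat) (x y : 'rV[R]_n) (r : R) : 0 < r ->
  sqnorm (y - x) < r ^+ 2 -> ball x r y.
Proof.
move=> r0 H; split => // i j; rewrite (ord1 i) /ball/= distrC.
rewrite -(ltr_pXn2r (ltn0Sn 1)) ?nnegrE ?(ltW r0)//.
rewrite real_normK ?num_real// (le_lt_trans _ H)// /sqnorm (bigD1 j)//= !mxE.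
by rewrite lerDl sumr_ge0// => k _; rewrite sqr_ge0.
Qed.

Section comparison.
Context {R : realType} (n : nat) (G : set 'rV[R]_n) (T alpha nu : R).
Context (F u ubar : 'rV[R]_n -> R -> R).
Hypotheses (n0 : (0 < n)%N) (oG : open G) (cG : compact (closure G)).
Hypotheses (alpha0 : 0 < alpha) (alpha1 : alpha < 1) (nu0 : 0 < nu) (T1 : 1 < T).
Hypotheses (solu : classical_solution G T alpha nu F u)
           (solub : classical_solution G T alpha nu F ubar).
Hypothesis gap_bdry : forall x t, bdry G x -> 1 <= t <= T -> u x t = ubar x t.

Local Notation w := (solution_gap n u ubar).
Local Notation Hd x := (had alpha 1 (w x)).

Let gc := gap_continuous n G T alpha nu F u ubar solu solub.
Let gtc := gap_time_continuous n G T alpha nu F u ubar solu solub.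
Let gam0 : 0 < (Gamma alpha)^-1. Proof. by rewrite invr_gt0 Gamma_gt0. Qed.

Lemma spatial_max_had (x0 x1 : 'rV[R]_n) (a b c om : R) :
  G x0 -> 1 < a -> a <= b -> b <= T ->
  (forall y, G y -> Hd y b - Hd y a - c * sqnorm (y - x1) <=
     Hd x0 b - Hd x0 a - c * sqnorm (x0 - x1)) ->
  {in `[a, b], forall t, `|w x0 t - w x0 b| <= om} ->
  (w x0 b - w x0 a) / a <=
    om * (a^-1 - b^-1) + 2 * ((Gamma alpha)^-1 * c) * n%:R * nu.
Proof.
move=> Gx0 a1 ab bT Hmax Hom.
apply: (spatial_max n G T alpha nu F u ubar oG alpha0 nu0 solu solub x0 x1 a b
  ((Gamma alpha)^-1 * c) om Gx0 a1 ab bT) => // y Gy.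
rewrite !hadamard_intE -!mulrA -!mulrBr ler_pM2l//; exact: Hmax.
Qed.

Lemma had_gap_bdry x t : bdry G x -> t <= T -> Hd x t = 0.
Proof.
move=> bx tT; have [t1|t1] := leP t 1; first by rewrite had_degenerate.
rewrite (eq_had alpha 1 t (w x) (cst 0)); last first.
  move=> s; rewrite in_itv/= => /andP[s1 st]; rewrite /solution_gap gap_bdry ?subrr//.
  by rewrite s1 (le_trans st).
by rewrite (had_cst alpha 1 t alpha0 ltr01 0 (ltW t1)) mul0r.
Qed.

(** The limit case a = 1 of spatial_max_had, when the equation is not
available at the initial time. For a slightly larger than 1, Hd y b - Hd y a
need not be maximal at x0, but it is close to Hd y b uniformly in y, so that
with a small quadratic penalty it is maximal at some y1 in G close to x0. *)
Lemma initial_max x0 b om : G x0 -> 1 < b -> b <= T -> 0 <= om ->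
  (forall x t, closure G x -> t \in `[1, b] -> `|w x t - w x b| <= om) ->
  (forall y, closure G y -> Hd y b <= Hd x0 b) -> 0 < Hd x0 b ->
  w x0 b - w x0 1 <= om * (b - 1).
Proof.
have sum3 (x1 x2 x3 x4 y e : R) : 0 < e -> x1 - x2 < e / 4 -> - (e / 4) < x3 - x4 ->
  x2 - x4 <= y + e / 4 -> x1 - x3 <= y + e by lra.
have sum2 (x1 x2 x3 x4 y : R) : x1 <= x2 -> - y <= x3 -> x2 - y <= x1 - x3 - x4 ->
  x4 <= y *+ 2 by rewrite mulr2n; lra.
move=> Gx0 b1 bT om0 Hom Hmax H0; apply/ler_addgt0Pr => e e0.
have subG := @subset_closure _ G.
have cK := compact_setX cG (@segment_compact R 1 T).
have e40 : 0 < e / 4 by rewrite divr_gt0.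
have [r r0 hr] := compact_uniform_continuity _ _ cK gc _ e40.
have [N N0 hN] := compact_continuous_bounded _ _ cK gc.
(* The factor c of the penalty is chosen so that its contribution to the bound
   is at most e / 4. The bound eta on |Hd y a| forces the maximum point y1 to be
   in G, where Hd is not close to 0, and within r of x0, so that w varies by
   less than e / 4. *)
pose K : R := 2 * (Gamma alpha)^-1 * n%:R * nu * T.
have T0 : 0 < T by exact: lt_trans T1.
have K0 : 0 < K by rewrite !mulr_gt0// ltr0n.
pose c := e / 4 / K.
have c0 : 0 < c by rewrite divr_gt0.
pose eta := Num.min (Hd x0 b) (c * r ^+ 2) / 3.
have m0 : 0 < Num.min (Hd x0 b) (c * r ^+ 2).
  by rewrite lt_min H0 mulr_gt0// exprn_gt0.
have eta0 : 0 < eta by rewrite divr_gt0.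
have eta1 : eta < Hd x0 b.
  rewrite (@lt_le_trans _ _ (Num.min (Hd x0 b) (c * r ^+ 2)))//.
    by rewrite /eta ltr_pdivrMr// ltr_pMr// ltr1n.
  by rewrite ge_min lexx.
have eta2 : eta *+ 2 < c * r ^+ 2.
  rewrite (@lt_le_trans _ _ (Num.min (Hd x0 b) (c * r ^+ 2)))//.
    by move: m0; rewrite /eta; move: (Num.min _ _) => m m_; lra.
  by rewrite ge_min lexx orbT.
have I1 : `[1, T]%classic (1 : R) by rewrite /= in_itv/= lexx ltW.
have d00 : 0 < eta * alpha / N by rewrite divr_gt0// mulr_gt0.
have [d d0 hd] := (within_continuousP _ _).1
  (ln_powR_within_continuous alpha T alpha0) 1 I1 _ d00.
pose s0 := Num.min (b - 1) (Num.min r d).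
have s00 : 0 < s0 by rewrite !lt_min subr_gt0 b1 r0.
pose a := 1 + s0 / 2.
have s02 : s0 / 2 < s0 by rewrite ltr_pdivrMr// ltr_pMr// ltr1n.
have a1 : 1 < a by rewrite ltrDl divr_gt0.
have [ab ar ad] : [/\ a < b, a - 1 < r & a - 1 < d].
  have : a - 1 < s0 by rewrite /a addrC addKr.
  by rewrite !lt_min => /and3P[h1 h2 h3]; split => //; rewrite -(ltrD2r (- 1)).
have aT : a <= T by rewrite (le_trans (ltW ab)).
have Ia : `[1, T]%classic a by rewrite /= in_itv/= ltW.
have Ib : `[1, T]%classic b by rewrite /= in_itv/= ltW.
have small y : closure G y -> `|Hd y a| <= eta.
  move=> Gy.
  have cy : {within `[1, a], continuous (w y)}.
    by apply: continuous_subspaceW (gtc y Gy); apply: subset_itv; rewrite bnd_simp.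
  have H : {in `[1, a], forall s, `|w y s| <= N}.
    move=> s; rewrite in_itv/= => /andP[s1 sa]; apply: (hN (y, s)).
    by split => //=; rewrite in_itv/= s1 (le_trans sa).
  have := had_norm_le alpha 1 a alpha0 ltr01 (w y) N (ltW a1) cy H.
  move/le_trans; apply; rewrite divr1.
  have ba : ball (1 : R) d a by rewrite /ball/= distrC gtr0_norm ?subr_gt0.
  have := hd a Ia ba; rewrite ln1 powR0 ?gt_eqF// sub0r normrN ger0_norm ?powR_ge0//.
  move=> /ltW h; rewrite mulrA ler_pdivrMr//.
  by rewrite mulrC -ler_pdivlMr.
have cH := had_joint_continuous (closure G) alpha 1 T w alpha0 cG gc.
pose f (y : 'rV[R]_n) := Hd y b - Hd y a - c * sqnorm (y - x0).
have cf : {within closure G, continuous f}.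
  have cb := slice_space_continuous (closure G) `[1, T] (fun y t => Hd y t) b Ib cH.
  have ca := slice_space_continuous (closure G) `[1, T] (fun y t => Hd y t) a Ia cH.
  have cs : {within closure G, continuous (fun y => sqnorm (y - x0))}.
    by apply: continuous_subspaceT; exact: sqnorm_continuous.
  move=> y; apply: cvgB; first by apply: cvgB; [exact: cb|exact: ca].
  by apply: cvgM; [exact: cvg_cst|exact: cs].
have neG : closure G !=set0 by exists x0; exact: subG.
have [y1 /set_mem Gy1 ymax] := compact_EVT_max neG cG cf.
have fx0 : f x0 = Hd x0 b - Hd x0 a.
  by rewrite /f subrr /sqnorm big1 ?mulr0 ?subr0// => i _; rewrite mxE expr0n.
have fy1 : Hd x0 b - eta <= f y1.
  rewrite (@le_trans _ _ (f x0))//; last by apply: ymax; exact/mem_set/subG.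
  rewrite fx0 lerD2l lerN2; have := small x0 (subG _ Gx0).
  by rewrite ler_norml => /andP[].
have q0 : 0 <= c * sqnorm (y1 - x0).
  by rewrite mulr_ge0 ?(ltW c0)// sumr_ge0// => i _; rewrite sqr_ge0.
have Giy1 : G y1.
  have [//|by1] := bdry_closureD n G y1 oG Gy1.
  have : f y1 <= 0.
    by rewrite /f !had_gap_bdry// subrr sub0r oppr_le0.
  move/(le_trans fy1); rewrite subr_le0 => /(lt_le_trans eta1).
  by rewrite ltxx.
have yb : ball x0 r y1.
  apply: sqnorm_lt_ball => //; rewrite -(ltr_pM2l c0) (le_lt_trans _ eta2)//.
  have h1 := small y1 Gy1; have h2 := Hmax y1 Gy1.
  move: h1 fy1; rewrite ler_norml /f => /andP[h1 _].
  exact: sum2 h2 h1.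
have S := spatial_max_had y1 x0 a b c om Giy1 a1 (ltW ab) bT _ _.
have {}S : (w y1 b - w y1 a) / a <=
    om * (a^-1 - b^-1) + 2 * ((Gamma alpha)^-1 * c) * n%:R * nu.
  apply: S => [y Gy|t]; first by have := ymax y (mem_set (subG _ Gy)).
  rewrite in_itv/= => /andP[at' tb]; apply: Hom => //.
  by rewrite in_itv/= tb (le_trans (ltW a1)).
have a0 : 0 < a by exact: lt_trans a1.
have b0 : 0 < b by exact: lt_trans b1.
have S2 : w y1 b - w y1 a <= om * (b - 1) + e / 4.
  move: S; rewrite ler_pdivrMr// => /le_trans; apply; rewrite mulrDl lerD//.
    rewrite -mulrA ler_wpM2l// mulrBl mulVf ?gt_eqF//.
    apply: (@le_trans _ _ ((b - 1) / b)).
      rewrite mulrBl divff ?gt_eqF// lerD2l lerN2 mul1r ler_peMr//; last exact: ltW.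
      by rewrite invr_ge0 ltW.
    rewrite ler_pdivrMr// ler_peMr//; last exact: ltW.
    by rewrite subr_ge0 ltW.
  have -> : 2 * ((Gamma alpha)^-1 * c) * n%:R * nu * a = e / 4 * (a / T).
    rewrite /c /K; field; rewrite (gt_eqF nu0) (gt_eqF T0) (gt_eqF (Gamma_gt0 _ alpha0 alpha1)).
    by rewrite pnatr_eq0 -lt0n n0.
  by rewrite ler_piMr ?(ltW e40)// ler_pdivrMr// mul1r.
have B1 : `|w x0 b - w y1 b| < e / 4.
  apply: (hr (x0, b) (y1, b)).
  - by split => //; exact: subG.
  - by split.
  - by split => //=; exact: ballxx.
have B2 : `|w x0 1 - w y1 a| < e / 4.
  apply: (hr (x0, 1) (y1, a)).
  - by split => //; exact: subG.
  - by split.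
  - by split => //=; rewrite /ball/= distrC gtr0_norm ?subr_gt0.
move: B1 B2 S2; rewrite !ltr_norml => /andP[_ B1] /andP[B2 _].
exact: sum3 e0 B1 B2.
Qed.

Context (delta : R).
Hypothesis delta0 : 0 <= delta.
Hypothesis gap_init : forall x, closure G x -> w x 1 <= delta.

(** * Dilation increments and the conclusion *)

Definition gap_excess (x : 'rV[R]_n) (t : R) : R := w x t - delta.
Local Notation W := gap_excess.

Lemma excess_continuous : {within closure G `*` `[1, T], continuous (fun p => W p.1 p.2)}.
Proof. by move=> p; apply: cvgB; [exact: gc|exact: cvg_cst]. Qed.

Lemma had_excess x t : closure G x -> t <= T ->
  had alpha 1 (W x) t = Hd x t - had alpha 1 (cst delta) t.
Proof.
move=> Gx tT; apply: (hadB alpha 1 t alpha0 ltr01 (w x) (cst delta)).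
  by apply: continuous_subspaceW (gtc x Gx); apply: subset_itv; rewrite bnd_simp.
exact: cst_within_continuous.
Qed.

(** On ]1, T] this is the differentiability of the Hadamard integrals of the
two solutions, and had_cst_left_lipschitz for the constant delta; up to 1 the
integral is 0. *)
Lemma had_excess_left_lipschitz x t : G x -> t <= T ->
  exists K d, 0 < d /\ forall s, s <= t -> t - s < d ->
    `|had alpha 1 (W x) t - had alpha 1 (W x) s| <= K * (t - s).
Proof.
move=> Gx tT; have Gx' := @subset_closure _ G _ Gx.
have [t1|t1] := leP t 1.
  exists 0, 1; split => // s st _.
  by rewrite !had_degenerate ?(le_trans st)// subrr normr0 mul0r.
have O : Omega G T (x, t) by split => //=; rewrite in_itv/= t1.
have [K1 [d1 [d10 h1]]] := derivable_within_lipschitz _ _ _ (sol_hadamard solu O).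
have [K2 [d2 [d20 h2]]] := derivable_within_lipschitz _ _ _ (sol_hadamard solub O).
have [K3 [d3 [d30 h3]]] := had_cst_left_lipschitz alpha delta t alpha0 alpha1.
exists (Gamma alpha * (K1 + K2) + K3), (Num.min (t - 1) (Num.min d1 (Num.min d2 d3))).
split; first by rewrite !lt_min subr_gt0 t1 d10 d20.
move=> s st; rewrite !lt_min => /and4P[s1 sd1 sd2 sd3].
have sI : `[1, T]%classic s.
  rewrite /= in_itv/= (le_trans st)// andbT ltW//.
  by move: s1; rewrite ltrD2l ltrN2.
have sT : s <= T by exact: le_trans tT.
have ts : `|t - s| = t - s by rewrite ger0_norm// subr_ge0.
have H v : hadamard_int alpha v = fun t => (Gamma alpha)^-1 * had alpha 1 v t.
  by apply/funext => r; rewrite hadamard_intE.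
have {}h1 := h1 s sI; have {}h2 := h2 s sI; have {}h3 := h3 s st sd3.
rewrite ts in h1 h2; have {}h1 := h1 sd1; have {}h2 := h2 sd2.
have E1 := hadamard_gap n G T alpha nu F u ubar alpha0 solu solub x t Gx' tT.
have E2 := hadamard_gap n G T alpha nu F u ubar alpha0 solu solub x s Gx' sT.
rewrite (had_excess x t Gx' tT) (had_excess x s Gx' sT).
have GE r : Hd x r = Gamma alpha * hadamard_int alpha (w x) r.
  by rewrite hadamard_intE mulrA divff ?mul1r// gt_eqF// Gamma_gt0.
rewrite !GE E1 E2.
move: h1 h2 h3; have := Gamma_gt0 alpha alpha0 alpha1.
generalize (Gamma alpha) (hadamard_int alpha (u x) t) (hadamard_int alpha (ubar x) t)
  (hadamard_int alpha (u x) s) (hadamard_int alpha (ubar x) s)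
  (had alpha 1 (cst delta) t) (had alpha 1 (cst delta) s) (t - s).
move=> g a b c d k l r g0 h1 h2 h3.
have -> : g * (a - b) - k - (g * (c - d) - l) = g * (a - c) - g * (b - d) - (k - l).
  by ring.
rewrite (le_trans (ler_normB _ _))// mulrDl lerD// (le_trans (ler_normB _ _))//.
by rewrite !normrM gtr0_norm// -mulrA mulrDl mulrDr lerD// ler_pM2l.
Qed.

(** At a positive maximum (x0, t0) of the increments, the time part bounds the
maximum by a multiple of w(x0, q * t0) - w(x0, max(1, t0)). Since x0 also
maximizes the increment in space, the space part, or its limit case when
t0 <= 1, bounds this difference by a multiple of q - 1 times the oscillation of
w at scale q - 1. A positive maximum is not reached on the boundary: there w = 0, and the
increments of the integral of the constant - delta are at most 0. *)
Lemma dilation_bound e : 0 < e -> exists2 q0, 1 < q0 &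
  forall q, 1 < q -> q <= q0 -> forall x t, closure G x -> t \in `[q^-1, T / q] ->
  had alpha 1 (W x) (q * t) - had alpha 1 (W x) t <= e * (q - 1).
Proof.
have dif4 (x1 x2 x3 x4 y z : R) : x1 - x3 <= y -> - z <= x2 - x4 ->
  x1 - x2 - (x3 - x4) <= y + z by lra.
move=> e0; have T0 : 0 < T by exact: lt_trans T1.
have a01 : 0 < alpha < 1 by rewrite alpha0.
have C1 := beta_const_ge1 alpha a01.
have C0 : 0 < beta_const alpha by exact: lt_le_trans C1.
have lT : 0 < ln T by exact: ln_gt0.
have P0 : 0 < ln T `^ alpha by exact: powR_gt0.
pose D := beta_const alpha * ln T `^ alpha * T.
have D0 : 0 < D by rewrite !mulr_gt0.
pose e1 := e / D.
have e10 : 0 < e1 by rewrite divr_gt0.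
have cK := compact_setX cG (@segment_compact R 1 T).
have [d d0 hd] := compact_uniform_continuity _ _ cK gc _ e10.
exists (1 + d / (2 * T)); first by rewrite ltrDl divr_gt0// mulr_gt0.
move=> q q1 qq0.
have q0 : 0 < q by exact: lt_trans q1.
have qV0 : 0 < q^-1 by rewrite invr_gt0.
have q10 : 0 < q - 1 by rewrite subr_gt0.
have qd : (q - 1) * T < d.
  rewrite (@le_lt_trans _ _ (d / (2 * T) * T))//.
    by rewrite ler_pM2r// lerBlDl.
  by rewrite invfM mulrA divfK ?gt_eqF// ltr_pdivrMr// ltr_pMr// ltr1n.
have [neG x t Gx tI|eG x t Gx] := pselect (closure G !=set0); last by case: eG; exists x.
pose kk (p : 'rV[R]_n * R) := had alpha 1 (W p.1) (q * p.2) - had alpha 1 (W p.1) p.2.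
have ck : {within closure G `*` `[q^-1, T / q], continuous kk}.
  have ch := had_joint_continuous (closure G) alpha q^-1 T W alpha0 cG excess_continuous.
  have c1 : {within closure G `*` `[q^-1, T / q],
      continuous (fun p => had alpha 1 (W p.1) p.2)}.
    apply: continuous_subspaceW ch => -[y s] [/= Gy]; rewrite !in_itv/= => /andP[s1 s2].
    split => //; rewrite /= ?in_itv/= s1 (le_trans s2)// ler_pdivrMr// ler_peMr// ltW//.
  have c2 := dilate_continuous (closure G) q T (fun y t => had alpha 1 (W y) t) q1 ch.
  by move=> p; apply: cvgB; [exact: c2|exact: c1].
have cK2 := compact_setX cG (@segment_compact R q^-1 (T / q)).
have ne : closure G `*` `[q^-1, T / q] !=set0 by exists (x, t).
have [[x0 t0] /set_mem[/= Gx0 t0I] kmax] := compact_EVT_max ne cK2 ck.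
have {}kmax y s : closure G y -> s \in `[q^-1, T / q] -> kk (y, s) <= kk (x0, t0).
  by move=> Gy sI; apply: kmax; apply/mem_set.
apply: (le_trans (kmax x t Gx tI)).
have [M0|M0] := leP (kk (x0, t0)) 0.
  by rewrite (le_trans M0)// mulr_ge0// ltW.
move: (t0I); rewrite in_itv/= => /andP[t0q t0T].
have qt0T : q * t0 <= T by rewrite mulrC -ler_pdivlMr.
have t0T' : t0 <= T.
  by rewrite (le_trans t0T)// ler_pdivrMr// ler_peMr// ltW.
have {}t0q : q^-1 < t0.
  rewrite lt_neqAle t0q andbT; apply/negP => /eqP E; move: M0.
  rewrite /kk/= -E divff ?gt_eqF// !had_degenerate ?subrr ?ltxx//.
  by rewrite invf_le1// ltW.
have t00 : 0 < t0 by exact: lt_trans t0q.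
have qt01 : 1 < q * t0 by rewrite -(divff (lt0r_neq0 q0)) ltr_pM2l.
pose Dl := had alpha 1 (cst delta).
have DlE s : 1 <= s -> Dl s = delta * (ln s `^ alpha / alpha).
  by move=> s1; rewrite /Dl (had_cst alpha 1 s alpha0 ltr01 delta s1) divr1.
have Dl0 s : 0 <= Dl s.
  have [s1|s1] := leP s 1; first by rewrite /Dl had_degenerate.
  by rewrite DlE ?(ltW s1)// mulr_ge0// divr_ge0 ?powR_ge0// ltW.
have Dlm : Dl t0 <= Dl (q * t0).
  have [s1|s1] := leP t0 1; first by rewrite {1}/Dl had_degenerate.
  rewrite !DlE ?(ltW s1) ?(ltW qt01)// ler_wpM2l// ler_pM2r ?invr_gt0//.
  apply: (ge0_ler_powR (ltW alpha0)); rewrite ?nnegrE ?ln_ge0 ?(ltW s1) ?(ltW qt01)//.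
  rewrite ler_ln ?posrE// ?mulr_gt0//.
  by rewrite ler_peMl// ltW.
have kkE y : closure G y ->
    kk (y, t0) = Hd y (q * t0) - Hd y t0 - (Dl (q * t0) - Dl t0).
  move=> Gy; rewrite /kk/= (had_excess y _ Gy qt0T) (had_excess y _ Gy t0T').
  rewrite -/Dl; move: (Hd y _) (Hd y _) (Dl _) (Dl _) => g1 g2 g3 g4; ring.
have Gx0' : G x0.
  have [//|bx0] := bdry_closureD n G x0 oG Gx0.
  move: M0; rewrite kkE// !had_gap_bdry// subrr sub0r oppr_gt0 subr_lt0.
  by rewrite ltNge Dlm.
have [K1 [d1 [d10 h1]]] := had_excess_left_lipschitz x0 (q * t0) Gx0' qt0T.
have [K2 [d2 [d20 h2]]] := had_excess_left_lipschitz x0 t0 Gx0' t0T'.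
pose t1 := t0 - Num.min (d1 / q) d2 / 2.
have m0 : 0 < Num.min (d1 / q) d2 by rewrite lt_min d20 divr_gt0.
have t10 : t1 < t0 by rewrite ltrBlDr ltrDl divr_gt0.
have lip : {in `[t1, t0], forall s, kk (x0, t0) - kk (x0, s) <= (K1 * q + K2) * (t0 - s)}.
  move=> s; rewrite in_itv/= => /andP[t1s st0].
  have : t0 - s < Num.min (d1 / q) d2.
    rewrite (@le_lt_trans _ _ (Num.min (d1 / q) d2 / 2))//.
      by rewrite lerBlDr -lerBlDl.
    by rewrite ltr_pdivrMr// ltr_pMr// ltr1n.
  rewrite lt_min ltr_pdivlMr// => /andP[sd1 sd2].
  have sq : q * s <= q * t0 by rewrite ler_pM2l.
  have sdq : q * t0 - q * s < d1 by rewrite -mulrBr mulrC.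
  have := h1 (q * s) sq sdq; have := h2 s st0 sd2.
  rewrite -mulrBr !ler_norml => /andP[H2 _] /andP[_ H1].
  rewrite /kk/= mulrDl -mulrA; exact: dif4 H1 H2.
have kmaxt : {in `[q^-1, t0], forall s, kk (x0, s) <= kk (x0, t0)}.
  move=> s; rewrite in_itv/= => /andP[s1 s2]; apply: kmax => //.
  by rewrite in_itv/= s1 (le_trans s2).
have cW : {within `[1, T], continuous (W x0)}.
  by move=> s; apply: cvgB; [exact: (gtc x0 Gx0)|exact: cvg_cst].
have W1 : W x0 1 <= 0 by rewrite /gap_excess subr_le0; exact: gap_init.
have := had_dilation_max alpha a01 T q t0 t1 (K1 * q + K2) (W x0) q1 t0q qt0T cW W1
  M0 kmaxt t10 lip.
have WE s : W x0 (q * t0) - W x0 s = w x0 (q * t0) - w x0 s.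
  by rewrite /gap_excess opprB addrA subrK.
rewrite WE -/(kk (x0, t0)) => main.
suff wb : w x0 (q * t0) - w x0 (Num.max 1 t0) <= e1 * ((q - 1) * T).
  have {}main := le_trans main (ler_wpM2l (ltW C0) wb).
  have E : kk (x0, t0) = kk (x0, t0) * ln T `^ (- alpha) * ln T `^ alpha.
    by rewrite -mulrA -powRD ?addNr ?powRr0 ?mulr1//; apply/implyP => _; rewrite gt_eqF.
  rewrite E (le_trans (ler_wpM2r (ltW P0) main))// le_eqVlt; apply/orP; left; apply/eqP.
  rewrite /e1 /D; have T0' := lt0r_neq0 T0; move: (lt0r_neq0 P0) (lt0r_neq0 C0).
  by generalize (ln T `^ alpha) (beta_const alpha) => p C p0 C0'; field; rewrite p0 C0' T0'.
have uni y s s' : closure G y -> s \in `[1, T] -> s' \in `[1, T] -> `|s - s'| < d ->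
    `|w y s - w y s'| <= e1.
  move=> Gy sI s'I ss'; apply: ltW; apply: (hd (y, s) (y, s')) => //.
  by split => //=; exact: ballxx.
have qt0t0 : q * t0 - t0 <= (q - 1) * T.
  by rewrite -[X in _ - X]mul1r -mulrBl ler_pM2l.
have bI : q * t0 \in `[1, T] by rewrite in_itv/= (ltW qt01).
case: (leP t0 1) => t01.
- have wb : w x0 (q * t0) - w x0 1 <= e1 * (q * t0 - 1).
    have Hz y : Hd y t0 = 0 by rewrite had_degenerate.
    apply: initial_max => //; first exact: ltW.
    + move=> y s Gy; rewrite in_itv/= => /andP[s1 sb]; apply: uni => //.
        by rewrite in_itv/= s1 (le_trans sb).
      rewrite distrC ger0_norm ?subr_ge0// (le_lt_trans _ qd)// (le_trans _ qt0t0)//.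
      by rewrite lerD2l lerN2 (le_trans t01).
    + move=> y Gy; have := kmax y t0 Gy t0I; rewrite !kkE// !Hz.
      by rewrite !subr0 lerD2r.
    + move: M0; rewrite kkE// Hz subr0 subr_gt0; apply: le_lt_trans.
      by rewrite subr_ge0.
  rewrite (le_trans wb)// ler_pM2l// (le_trans _ qt0t0)// lerD2l lerN2//.
- have t0q' : t0 <= q * t0 by rewrite ler_peMl// ltW.
  have H y : G y -> Hd y (q * t0) - Hd y t0 - 0 * sqnorm (y - x0) <=
      Hd x0 (q * t0) - Hd x0 t0 - 0 * sqnorm (x0 - x0).
    move=> Gy; have Gy' := @subset_closure _ G _ Gy.
    by have := kmax y t0 Gy' t0I; rewrite !kkE// !mul0r !subr0 lerD2r.
  have U : {in `[t0, q * t0], forall s, `|w x0 s - w x0 (q * t0)| <= e1}.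
    move=> s; rewrite in_itv/= => /andP[s1 sb]; apply: uni => //.
      by rewrite in_itv/= (le_trans sb)// (le_trans (ltW t01)).
    rewrite distrC ger0_norm ?subr_ge0// (le_lt_trans _ qd)// (le_trans _ qt0t0)//.
    by rewrite lerD2l lerN2.
  have := spatial_max_had x0 x0 t0 (q * t0) 0 e1 Gx0' t01 t0q' qt0T H U.
  rewrite !mulr0 !mul0r addr0 ler_pdivrMr// => /le_trans; apply.
  rewrite -mulrA ler_pM2l// mulrBl mulVf ?gt_eqF//.
  rewrite invfM -mulrA mulVf ?gt_eqF// mulr1.
  apply: (@le_trans _ _ (q - 1)); last by rewrite ler_peMr// ltW.
  have -> : 1 - q^-1 = (q - 1) / q by rewrite mulrBl divff ?gt_eqF// mul1r.
  by rewrite ler_pdivrMr// ler_peMr// ltW.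
Qed.

(** If W >= m > 0 on an interval [t2, t], then for q close to 1 the integral
of W(s) ds/s over [t2, q * t2] is at least of order m * (q - 1). By the dilation
identity it is, up to a constant, an integral of the increments, which are at
most e * (q - 1) with e as small as desired. *)
Lemma gap_excess_le0 x t : closure G x -> t \in `[1, T] -> W x t <= 0.
Proof.
move=> Gx tI; rewrite leNgt; apply/negP => W0.
have cW : {within `[1, T], continuous (W x)}.
  by move=> s; apply: cvgB; [exact: (gtc x Gx)|exact: cvg_cst].
move: (tI); rewrite in_itv/= => /andP[t1 tT].
have W1 : W x 1 <= 0 by rewrite /gap_excess subr_le0; exact: gap_init.
have {}t1 : 1 < t.
  rewrite lt_neqAle t1 andbT; apply/negP => /eqP E; move: W0.
  by rewrite -E ltNge W1.
pose m := W x t / 2; have m0 : 0 < m by rewrite divr_gt0.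
have [d d0 hd] := (within_continuousP _ _).1 cW t tI m m0.
pose t2 := Num.max ((1 + t) / 2) (t - d / 2).
have t21 : 1 < t2.
  by rewrite lt_max ltr_pdivlMr// mul1r -[ltLHS]/(1 + 1) ltrD2l t1.
have t2t : t2 < t.
  rewrite gt_max ltrBlDr ltrDl divr_gt0// andbT ltr_pdivrMr// mulr2n mulrDr mulr1.
  by rewrite ltrD2r.
have t2d : t - t2 < d.
  rewrite ltrBlDr -ltrBlDl lt_max ltrD2l ltrN2; apply/orP; right.
  by rewrite ltr_pdivrMr// ltr_pMr// ltr1n.
have t20 : 0 < t2 by exact: lt_trans t21.
have Wm s : s \in `[t2, t] -> m <= W x s.
  rewrite in_itv/= => /andP[s2 st].
  have sI : `[1, T]%classic s.
    by rewrite /= in_itv/= (le_trans (ltW t21))// (le_trans st).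
  have bs : ball t d s.
    by rewrite /ball/= ger0_norm ?subr_ge0// (le_lt_trans _ t2d)// lerD2l lerN2.
  have := hd s sI bs; rewrite ltr_norml => /andP[_] /ltW.
  have -> : W x t = m + m by rewrite /m -splitr.
  by rewrite lerBlDr lerD2l.
have a01 : 0 < alpha < 1 by rewrite alpha0.
have b0 : 0 < 1 - alpha by rewrite subr_gt0.
have C0 : 0 < beta_const alpha.
  exact: (lt_le_trans ltr01 (beta_const_ge1 alpha a01)).
have T0 : 0 < T by exact: lt_trans T1.
(* B bounds the integral of order 1 - alpha of the constant 1; e is such that
   e * (B + 1) is the lower bound divided by q - 1. *)
pose B := ln T `^ (1 - alpha) / (1 - alpha).
have B0 : 0 <= B by rewrite divr_ge0 ?powR_ge0// ltW.
have B1 : 0 < B + 1 by rewrite ltr_wpDl.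
pose e := beta_const alpha * m / (T * (B + 1)).
have e0 : 0 < e by rewrite divr_gt0// mulr_gt0.
have [q0 q01 hq] := dilation_bound e e0.
pose q := Num.min q0 (t / t2).
have q1 : 1 < q by rewrite lt_min q01 ltr_pdivlMr// mul1r.
have q_0 : 0 < q by exact: lt_trans q1.
have qV0 : 0 < q^-1 by rewrite invr_gt0.
have qV1 : q^-1 < 1 by rewrite invf_lt1.
have qt : q * t2 <= t by rewrite -ler_pdivlMr// ge_min lexx orbT.
have qtT : q * t2 <= T by exact: le_trans tT.
have qT : q <= T by rewrite (le_trans _ qtT)// ler_peMr ?ltW.
have qt2 : t2 <= q * t2 by rewrite ler_peMl ?ltW.
have qVt2 : q^-1 <= t2 by rewrite ltW// (lt_trans qV1).
have t2T : t2 <= T by exact: le_trans qtT.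
have cq : {within `[1, q * t2], continuous (W x)}.
  by apply: continuous_subspaceW cW; apply: subset_itv; rewrite bnd_simp.
pose k s := had alpha 1 (W x) (q * s) - had alpha 1 (W x) s.
have ch := had_continuous_extended alpha q^-1 T (W x) alpha0 cW.
have ck : {within `[q^-1, t2], continuous k}.
  have c1 : {within `[q^-1, t2], continuous (had alpha 1 (W x))}.
    by apply: continuous_subspaceW ch; apply: subset_itv; rewrite bnd_simp.
  have c2 : {within `[q^-1, t2], continuous (fun s => had alpha 1 (W x) (q * s))}.
    apply: (within_compM_continuous q q^-1 t2 _ q_0).
    apply: continuous_subspaceW ch; apply: subset_itv; rewrite bnd_simp//.
    by rewrite divff ?gt_eqF// ltW.
  by move=> s; apply: cvgB; [exact: c2|exact: c1].
have upper : had (1 - alpha) q^-1 k t2 <= e * (q - 1) * B.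
  have kle : {in `[q^-1, t2], forall s, k s <= cst (e * (q - 1)) s}.
    move=> s; rewrite in_itv/= => /andP[s1 s2]; apply: hq => //.
      by rewrite ge_min lexx.
    by rewrite in_itv/= s1 ler_pdivlMr// mulrC (le_trans _ qtT)// ler_pM2l.
  apply: (le_trans (had_le (1 - alpha) q^-1 t2 b0 qV0 k (cst (e * (q - 1))) ck
    (cst_within_continuous _ _) kle)).
  rewrite (had_cst (1 - alpha) q^-1 t2 b0 qV0 _ qVt2) ler_wpM2l//.
    by rewrite mulr_ge0 ?(ltW e0)// subr_ge0 ltW.
  rewrite ler_pM2r ?invr_gt0// invrK mulrC.
  have qt21 : 1 < q * t2 by rewrite (lt_le_trans t21).
  apply: (ge0_ler_powR (ltW b0)); rewrite ?nnegrE ?ln_ge0 ?(ltW T1) ?(ltW qt21)//.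
  by rewrite ler_ln ?posrE// mulr_gt0.
have lower : beta_const alpha * (m * ln q) <= had (1 - alpha) q^-1 k t2.
  rewrite (had_dilation_increment alpha a01 q t2 (W x) (ltW q1) qVt2 cq).
  rewrite (had1_sub t2 (q * t2) (W x) (ltW t21) qt2 cq) ler_pM2l//.
  have cq2 : {within `[t2, q * t2], continuous (W x)}.
    by apply: continuous_subspaceW cq; apply: subset_itv; rewrite bnd_simp// ltW.
  have Wm' : {in `[t2, q * t2], forall s, m <= W x s}.
    move=> s; rewrite in_itv/= => /andP[s1 s2]; apply: Wm.
    by rewrite in_itv/= s1 (le_trans s2).
  have := had1_ge t2 (q * t2) m (W x) t20 qt2 cq2 Wm'.
  by rewrite mulfK// gt_eqF.
have lnq : (q - 1) / T <= ln q.
  apply: (@le_trans _ _ ((q - 1) / q)).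
    by rewrite ler_pM2l ?subr_gt0// lef_pV2.
  rewrite mulrBl divff ?gt_eqF// mul1r.
  by have := ln_le_sub1 q^-1 qV0; rewrite lnV ?posrE// lerNl opprB.
have key : beta_const alpha * m * ((q - 1) / T) <= e * (q - 1) * B.
  apply: (le_trans _ (le_trans lower upper)).
  by rewrite mulrA ler_pM2l// mulr_gt0.
have E : beta_const alpha * m * ((q - 1) / T) = e * (q - 1) * (B + 1).
  rewrite /e; move: (lt0r_neq0 B1) (lt0r_neq0 T0).
  by generalize (B + 1) (beta_const alpha) => b c b_0 T_0; field; rewrite b_0 T_0.
have eq0 : 0 < e * (q - 1) by apply: mulr_gt0 e0 _; rewrite subr_gt0.
by move: key; rewrite E (ler_pM2l eq0) gerDl ler10.
Qed.

End comparison.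

Lemma bounded_closure_compact {R : realType} (n : nat) (G : set 'rV[R]_n) :
  bounded_set G -> compact (closure G).
Proof.
move=> [M [_ hM]]; apply: bounded_closed_compact; last exact: closed_closure.
exists (`|M| + 2); split; first exact: num_real.
move=> N MN x Gx.
have [y [Gy xy]] := Gx _ (nbhsx_ballx x 1 ltr01).
have yM : `|y| <= `|M| + 1.
  by apply: (hM (`|M| + 1)) => //; rewrite (le_lt_trans (ler_norm M))// ltrDl.
rewrite /= -(subrK y x) (le_trans (ler_normD _ _))//.
move: xy; rewrite -ball_normE/= => xy.
move: yM xy MN; move: `|y| `|x - y| => a b; move: `|M| => c; lra.
Qed.

Theorem theorem5p6 (R : realType) (n : nat) (hn : (0 < n)%N)
  (alpha nu T delta : R) (G : set 'rV[R]_n)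
  (halpha0 : 0 < alpha) (halpha1 : alpha < 1) (hnu : 0 < nu) (hT : 1 < T)
  (hG : smooth_bounded_domain G)
  (F psi : 'rV[R]_n -> R -> R) (phi phibar : 'rV[R]_n -> R)
  (hF : {within Omega_bar G T, continuous (fun p => F p.1 p.2)})
  (hpsi : {within bdry G `*` `[1, T], continuous (fun p => psi p.1 p.2)})
  (hphi : {within closure G, continuous phi})
  (hphibar : {within closure G, continuous phibar})
  (u ubar : 'rV[R]_n -> R -> R)
  (hu : classical_solution G T alpha nu F u)
  (hubar : classical_solution G T alpha nu F ubar)
  (hu_bdry : forall x t, bdry G x -> 1 <= t <= T -> u x t = psi x t)
  (hubar_bdry : forall x t, bdry G x -> 1 <= t <= T -> ubar x t = psi x t)
  (hu_init : forall x, closure G x -> u x 1 = phi x)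
  (hubar_init : forall x, closure G x -> ubar x 1 = phibar x)
  (hdelta : forall x, closure G x -> `|phi x - phibar x| <= delta) :
  forall x t, Omega_bar G T (x, t) -> `|u x t - ubar x t| <= delta.
Proof.
move=> x t [/= Gx tI]; have [_ oG _ bG _] := hG.
have cG := bounded_closure_compact n G bG.
have d0 : 0 <= delta by rewrite (le_trans _ (hdelta x Gx)).
have bd y s : bdry G y -> 1 <= s <= T -> u y s = ubar y s.
  by move=> by_ sT; rewrite hu_bdry// hubar_bdry.
have bd' y s (by_ : bdry G y) (sT : 1 <= s <= T) := esym (bd y s by_ sT).
have i1 y : closure G y -> solution_gap n u ubar y 1 <= delta.
  move=> Gy; rewrite /solution_gap hu_init// hubar_init//.
  exact: le_trans (ler_norm _) (hdelta y Gy).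
have i2 y : closure G y -> solution_gap n ubar u y 1 <= delta.
  move=> Gy; rewrite /solution_gap hu_init// hubar_init// -opprB.
  by rewrite (le_trans (ler_norm _))// normrN hdelta.
have h1 := gap_excess_le0 n G T alpha nu F u ubar hn oG cG halpha0 halpha1 hnu hT
  hu hubar bd delta d0 i1 x t Gx tI.
have h2 := gap_excess_le0 n G T alpha nu F ubar u hn oG cG halpha0 halpha1 hnu hT
  hubar hu bd' delta d0 i2 x t Gx tI.
move: h1 h2; rewrite /gap_excess /solution_gap !subr_le0 ler_norml => -> h2.
by rewrite andbT -lerN2 opprK opprB.
Qed.
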